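(* Let $F:\mathcal{S}_n\to\mathbb{R}$ be uniformly elliptic, continuous and quasiconcave, and let $u,v\in C(B_1)$ be viscosity subsolutions of $F(D^2w)=0$ in $B_1\subset\mathbb{R}^n$. Then for every $\theta\in(0,1)$ the function $w=\theta u+(1-\theta)v$ is a viscosity subsolution of $F(D^2w)=0$ in $B_1$.
   Context: $\mathcal{S}_n$ is the space of real symmetric $n\times n$ matrices. $F$ is uniformly elliptic with constants $0<\lambda\le\Lambda$ if $\lambda\|N\|\leq F(M+N)-F(M)\leq\Lambda\|N\|$ for all $M,N\in\mathcal{S}_n$ with $N\geq0$, where $\|N\|=\sup_{|x|=1}|Nx|$. $F$ is quasiconcave if $F(\theta M_1+(1-\theta)M_2)\geq\min\{F(M_1),F(M_2)\}$ for all $M_1,M_2\in\mathcal{S}_n$, $\theta\in[0,1]$. A continuous $u$ is a viscosity subsolution of $F(D^2u)=0$ in $\Omega$ if whenever $\varphi\in C^2(\Omega)$ and $u-\varphi$ has a local maximum at $x_0\in\Omega$, then $F(D^2\varphi(x_0))\geq0$. *)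

(* Defs.v *)
From HB Require Import structures.
From mathcomp Require Import all_boot all_order all_algebra.
From mathcomp Require Import all_classical all_reals all_analysis.
Set Implicit Arguments. Unset Strict Implicit. Unset Printing Implicit Defensive.
Import Order.TTheory GRing.Theory Num.Theory.
Import numFieldNormedType.Exports.
Local Open Scope classical_set_scope.
Local Open Scope ring_scope.

Section Defs.
Variables (R : realType) (n : nat).

Definition enorm (x : 'rV[R]_n) : R := Num.sqrt (\sum_(i < n) x ord0 i ^+ 2).

Definition opnorm (N : 'M[R]_n) : R :=
  sup [set enorm (x *m N^T) | x in [set x : 'rV[R]_n | enorm x = 1]].

Definition symmx (M : 'M[R]_n) : Prop := M^T = M.

Definition psd (N : 'M[R]_n) : Prop := forall x : 'rV[R]_n, 0 <= (x *m N *m x^T) ord0 ord0.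

Definition unif_elliptic (F : 'M[R]_n -> R) (lam Lam : R) : Prop :=
  0 < lam /\ lam <= Lam /\
  forall M N : 'M[R]_n, symmx M -> symmx N -> psd N ->
    lam * opnorm N <= F (M + N) - F M /\ F (M + N) - F M <= Lam * opnorm N.

Definition quasiconcave (F : 'M[R]_n -> R) : Prop :=
  forall (M1 M2 : 'M[R]_n) (t : R), symmx M1 -> symmx M2 -> 0 <= t <= 1 ->
    Num.min (F M1) (F M2) <= F (t *: M1 + (1 - t) *: M2).

Definition B1 : set 'rV[R]_n := [set x | enorm x < 1].

Definition evec (i : 'I_n) : 'rV[R]_n := delta_mx ord0 i.
Definition partial (i : 'I_n) (f : 'rV[R]_n -> R) : 'rV[R]_n -> R :=
  fun x => derive f x (evec i).

Definition C2_on (Omega : set 'rV[R]_n) (f : 'rV[R]_n -> R) : Prop :=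
  forall x, Omega x ->
    {for x, continuous f} /\
    forall i : 'I_n, derivable f x (evec i) /\ {for x, continuous (partial i f)} /\
      forall j : 'I_n, derivable (partial i f) x (evec j) /\
        {for x, continuous (partial j (partial i f))}.

Definition hessian (f : 'rV[R]_n -> R) (x : 'rV[R]_n) : 'M[R]_n :=
  \matrix_(i, j) partial j (partial i f) x.

Definition visc_subsol (F : 'M[R]_n -> R) (Omega : set 'rV[R]_n)
    (u : 'rV[R]_n -> R) : Prop :=
  {within Omega, continuous u} /\
  forall (phi : 'rV[R]_n -> R) (x0 : 'rV[R]_n),
    C2_on Omega phi -> Omega x0 ->
    (\forall x \near x0, u x - phi x <= u x0 - phi x0) ->
    0 <= F (hessian phi x0).

End Defs.

(* Main.v *)
Require Import Defs.
From HB Require Import structures.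
From mathcomp Require Import all_boot all_order all_algebra.
From mathcomp Require Import all_classical all_reals all_analysis.
From mathcomp Require Import ring lra.
Set Implicit Arguments. Unset Strict Implicit. Unset Printing Implicit Defensive.
Import Order.TTheory GRing.Theory Num.Theory.
Import numFieldNormedType.Exports.
Local Open Scope classical_set_scope.
Local Open Scope ring_scope.

(* Since [F] is continuous, quasiconcave and elliptic, [0 <= F] defines a closed convex set of
   symmetric matrices which is stable under adding positive semidefinite ones.  If
   [F (hessian phi z) < 0] for a test function [phi], a hyperplane separates [hessian phi z]
   from it: there are [A], nonnegative on positive semidefinite matrices, and [c] such that
   [\tr (A *m hessian phi z) < c <= \tr (A *m M)] whenever [0 <= F M].  So [u] and [v] are
   viscosity subsolutions of the linear equation [\tr (A *m hessian w) = c], and it remains to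
   add and to rescale subsolutions of linear equations.

   A subsolution [w] of a linear equation is characterized by comparison on discs: if
   [\tr (A *m hessian psi) <= k < c] on a disc, then [w - psi] is bounded there by its values
   on the sphere.  To compare [u + v] with [psi], let [h] be a polynomial majorant of [u] which
   is close to [u] on the sphere, with [\tr (A *m hessian h)] a constant slightly below the one
   of [u], and compare [v] with [psi - h].  Such an [h] exists because [u] can be approximated on
   the sphere by a polynomial, and because the Dirichlet problem with polynomial data on a sphere
   has a polynomial solution. *)

(** * Second-order calculus *)

Section AlongLines.
Context {K : numFieldType} {V W : normedModType K}.
Implicit Types (f : V -> W) (x v w : V).

Lemma cvg_line x v : (x + t *: v) @[t --> (0 : K)] --> x.
Proof.
rewrite -[X in _ --> X]addr0 -(scale0r v).
exact: (cvgD (cvg_cst x) (@scalel_continuous K V v 0)).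
Qed.

Lemma is_derive_translate f x v w d :
  is_derive (x + w) v f d -> is_derive x v (fun y => f (y + w)) d.
Proof.
have quotE : (fun h : K => h^-1 *: (((fun y => f (y + w)) \o shift x) (h *: v) - f (x + w))) =
    (fun h : K => h^-1 *: ((f \o shift (x + w)) (h *: v) - f (x + w))).
  by apply/funext => h /=; rewrite addrA.
by move=> [fd fE]; split; rewrite /derivable /derive quotE.
Qed.

Lemma is_derive_line f x v (t : K) d :
  is_derive (x + t *: v) v f d -> is_derive t 1 (fun s => f (x + s *: v)) d.
Proof.
have quotE : (fun h : K => h^-1 *: (((fun s => f (x + s *: v)) \o shift t) (h *: 1)
    - f (x + t *: v))) =
    (fun h : K => h^-1 *: ((f \o shift (x + t *: v)) (h *: v) - f (x + t *: v))).
  apply/funext => h /=; congr (_ *: (f _ - _)).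
  by rewrite scalerDl [h *: 1]mulr1 addrCA.
by move=> [fd fE]; split; rewrite /derivable /derive quotE.
Qed.

End AlongLines.

Section MeanValue.
Context {R : realType}.
Implicit Types (g dg : R -> R) (c q : R).

Lemma MVT_line (V : normedModType R) (f : V -> R) (x v : V) (t : R) :
  (forall r : R, 0 <= r <= 1 -> derivable f (x + (t * r) *: v) v) ->
  exists2 r, 0 < r < 1 & f (x + t *: v) - f x = t * 'D_v f (x + (t * r) *: v).
Proof.
move=> fd; pose g r := f (x + (t * r) *: v).
have gd (r : R) : 0 <= r <= 1 -> is_derive r 1 g ('D_v f (x + (t * r) *: v) * t).
  move=> r01; have mul_td : is_derive r 1 (t \*: @id R) t.
    by apply: is_derive_eq; rewrite -[t *: 1]/(t * 1) mulr1.
  apply: (@is_derive1_comp R (fun s => f (x + s *: v)) (t \*: @id R)) mul_td.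
  by apply/is_derive_line/derivableP; exact: fd.
have [||r] := @MVT R g (fun r => 'D_v f (x + (t * r) *: v) * t) 0 1 ltr01.
- by move=> r /subset_itv_oo_cc; rewrite in_itv/= => /gd.
- by apply: derivable_within_continuous => r; rewrite in_itv/= => /gd[].
- rewrite in_itv/= => r01; rewrite /g mulr0 scale0r addr0 mulr1 subr0 mulr1 mulrC.
  by exists r.
Qed.

Lemma is_derive_gt0_near_lt g c q : is_derive c 1 g q -> 0 < q ->
  \forall t \near 0^'+, g (c - t) < g c < g (c + t).
Proof.
move=> [gd gE] q0.
have : \forall h \near 0^', 0 < h^-1 *: (g (h *: 1 + c) - g c).
  have : (h^-1 *: (g (h *: 1 + c) - g c) @[h --> 0^']) --> q by rewrite -gE.
  by move/cvgr_gt; apply.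
rewrite near_withinE => /nbhs_normP[d /= d0 quot_gt0].
exists d => //= t; rewrite /ball_/= sub0r normrN => td t0.
have tN0 : t != 0 by rewrite gt_eqF.
have := quot_gt0 t; have := quot_gt0 (- t); rewrite /ball_/= !sub0r !normrN oppr_eq0.
move=> /(_ td tN0) + /(_ td tN0).
rewrite -[_ *: 1]/(_ * 1) -[t *: 1]/(t * 1) !mulr1 ![_ + c]addrC.
rewrite -![_^-1 *: _]/(_^-1 * _) invrN mulNr -mulrN !pmulr_rgt0 ?invr_gt0//.
by lra.
Qed.

Lemma local_max_second_derive_le0 g dg c q :
  (\forall t \near c, is_derive (t : R) 1 g (dg t)) -> is_derive c 1 dg q ->
  (\forall t \near c, g t <= g c) -> q <= 0.
Proof.
move=> gd dgd gmax; rewrite leNgt; apply/negP => q0.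
have [d /= d0 near_c] := (nbhs_normP _ _).1 (filterI gd gmax).
have [t [t0 td dg_mono]] : exists t, [/\ 0 < t, t < d &
    forall s, 0 < s < t -> dg (c - s) < dg c < dg (c + s)].
  have [e /= e0 mono] := is_derive_gt0_near_lt dgd q0.
  exists (Num.min d e / 2); have m0 : 0 < Num.min d e by rewrite lt_min d0.
  have md : Num.min d e <= d by rewrite ge_min lexx.
  have me : Num.min d e <= e by rewrite ge_min lexx orbT.
  split=> [||s /andP[s0 se]]; [lra|lra|apply: mono => //].
  by rewrite /ball_/= sub0r normrN gtr0_norm//; lra.
have MVT_near_c a b : a < b -> c - t <= a -> b <= c + t ->
    exists2 s, a < s < b & g b - g a = dg s * (b - a).
  move=> ab ta bt.
  have gd_ab s : a <= s <= b -> is_derive s 1 g (dg s).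
    move=> /andP[a_le_s s_le_b]; apply: (near_c s _).1.
    by rewrite /ball_/= ltr_norml; lra.
  have [||s] := @MVT R g dg a b ab.
  - by move=> s /subset_itv_oo_cc; rewrite in_itv/= => /gd_ab.
  - by apply: derivable_within_continuous => s; rewrite in_itv/= => /gd_ab[].
  - by rewrite in_itv/=; exists s.
have g_le s : `|s| <= t -> g (c + s) <= g c.
  by move=> st; apply: (near_c _ _).2; rewrite /ball_/= opprD addrA subrr sub0r normrN; lra.
have [|||r /andP[cr rt] gr] := MVT_near_c c (c + t); [lra|lra|lra|].
have [|||s /andP[ts sc] gs] := MVT_near_c (c - t) c; [lra|lra|lra|].
have r_le0 : dg r <= 0.
  rewrite -(pmulr_lle0 _ t0) [X in _ * X](_ : t = c + t - c); last by ring.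
  by rewrite -gr subr_le0 g_le// gtr0_norm.
have s_ge0 : 0 <= dg s.
  rewrite -(pmulr_lge0 _ t0) [X in _ * X](_ : t = c - (c - t)); last by ring.
  by rewrite -gs subr_ge0 g_le// normrN gtr0_norm.
have := dg_mono (r - c); rewrite subrKC => /(_ _)/andP[|_ dgc_lt_dgr]; first lra.
have := dg_mono (c - s); rewrite subKr => /(_ _)/andP[|dgs_lt_dgc _]; first lra.
by lra.
Qed.

End MeanValue.

Section Partials.
Context {R : realType} {n : nat}.
Implicit Types (f : 'rV[R]_n -> R) (x y z w a : 'rV[R]_n) (Omega : set 'rV[R]_n).

Lemma mx_norm_leP m (M : 'M[R]_(m, n)) (c : R) : 0 <= c ->
  `|M| <= c <-> (forall i j, `|M i j| <= c).
Proof.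
move=> c0; rewrite [`|M|]mx_normrE; split=> [/bigmax_leP[_ Mc] i j|Mc].
  exact: (Mc (i, j)).
by apply/bigmax_leP; split.
Qed.

Lemma coord_le_mx_norm m (M : 'M[R]_(m, n)) i j : `|M i j| <= `|M|.
Proof. exact: (mx_norm_leP _ (normr_ge0 M)).1. Qed.

Lemma norm_evec_le1 (i : 'I_n) : `|evec R i| <= 1.
Proof.
apply/mx_norm_leP => // k j; rewrite mxE [k]ord1 eqxx/=.
by case: eqP => _; rewrite ?normr1 ?normr0.
Qed.

Lemma MVT_partials f x z :
  (forall y, `|y - x| <= `|z| -> forall i, derivable f y (evec R i)) ->
  exists2 w : 'I_n -> 'rV[R]_n, (forall i, `|w i| <= `|z|) &
    f (x + z) - f x = \sum_i z ord0 i * partial i f (x + w i).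
Proof.
move=> fd; pose trunc k : 'rV[R]_n := \row_j (if (j < k)%N then z ord0 j else 0).
have truncS (i : 'I_n) : trunc i.+1 = trunc i + z ord0 i *: evec R i.
  apply/rowP => j; rewrite !mxE eqxx/= ltnS [j == i]/eq_op/=.
  by case: (ltngtP j i) => ji; rewrite ?mulr0 ?addr0// mulr1 add0r; congr (z _ _); apply/val_inj.
have trunc_le (i : 'I_n) s : `|s| <= `|z ord0 i| -> `|trunc i + s *: evec R i| <= `|z|.
  move=> sz; apply/mx_norm_leP => // k j; rewrite [k]ord1 !mxE eqxx/=.
  have [->|ji] := eqVneq j i; rewrite ?ltnn ?mulr1 ?mulr0 ?add0r ?addr0.
    by rewrite (le_trans sz)// coord_le_mx_norm.
  by case: ifP => _; rewrite ?normr0// coord_le_mx_norm.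
have increment (i : 'I_n) : exists w, `|w| <= `|z| /\
    f (x + trunc i.+1) - f (x + trunc i) = z ord0 i * partial i f (x + w).
  have zr (r : R) : 0 <= r <= 1 -> `|z ord0 i * r| <= `|z ord0 i|.
    by move=> /andP[r0 r1]; rewrite normrM (ger0_norm r0) ler_piMr.
  have [r /zr/trunc_le wz|r /andP[/ltW r0 /ltW r1] fE] :=
      @MVT_line R _ f (x + trunc i) (evec R i) (z ord0 i).
    by apply: fd; rewrite addrAC [x + _ - x]addrAC subrr add0r.
  exists (trunc i + (z ord0 i * r) *: evec R i); split.
    by apply/trunc_le/zr; rewrite r0.
  by rewrite truncS !addrA.
have [w w_incr] := choice increment; exists w => [i|]; first by case: (w_incr i).
have -> : z = trunc n by apply/rowP => j; rewrite mxE ltn_ord.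
have {2}-> : x = x + trunc 0%N.
  by rewrite -[LHS]addr0; congr (_ + _); apply/rowP => j; rewrite !mxE.
rewrite -(@telescope_sumr _ 0 n (fun k => f (x + trunc k)))// big_mkord.
by apply: eq_bigr => i _; rewrite (w_incr i).2 mxE ltn_ord.
Qed.

Lemma is_derive_partials f x a :
  (\forall y \near x, forall i, derivable f y (evec R i)) ->
  (forall i, {for x, continuous (partial i f)}) ->
  is_derive x a f (\sum_i a ord0 i * partial i f x).
Proof.
move=> fd fc.
suff quot_cvg : (h^-1 *: ((f \o shift x) (h *: a) - f x) @[h --> 0^']) -->
    (\sum_i a ord0 i * partial i f x).
  by split; [apply/cvg_ex; eexists; exact: quot_cvg|exact: cvg_lim quot_cvg].
apply/cvgrPdist_le => e e0.
have [e' e'0 e'e] : exists2 e', 0 < e' & n%:R * `|a| * e' <= e.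
  have na0 : 0 < n%:R * `|a| + 1 by rewrite ltr_wpDl// mulr_ge0.
  exists (e / (n%:R * `|a| + 1)); first by rewrite divr_gt0.
  by rewrite mulrCA ger_pMr// ler_pdivrMr// mul1r lerDl.
have fe i : \forall y \near x, `|partial i f x - partial i f y| <= e'.
  by move: (fc i) => /cvgrPdist_le/(_ _ e'0).
have [d /= d0 near_x] := (nbhs_normP _ _).1 (filterI fd (filter_forall _ fe)).
rewrite near_withinE; apply/nbhs_normP.
exists (d / (`|a| + 1)); first by rewrite /= divr_gt0// ltr_wpDl.
move=> h; rewrite /ball_/= sub0r normrN ltr_pdivlMr ?ltr_wpDl// => hd h0.
have had : `|h *: a| < d.
  by rewrite normrZ (le_lt_trans _ hd)// ler_wpM2l// lerDl.
have [y yx i|w wh fE] := @MVT_partials f x (h *: a).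
  by apply: (near_x _ _).1; rewrite /ball_/= distrC (le_lt_trans yx).
rewrite [h *: a + x]addrC fE scaler_sumr -sumrB (le_trans (ler_norm_sum _ _ _))//.
apply: (@le_trans _ _ (\sum_(i < n) `|a| * e')).
  apply: ler_sum => i _; rewrite mxE -[_^-1 *: _]/(_^-1 * _) !mulrA mulVf// mul1r.
  rewrite -mulrBr normrM; apply: ler_pM => //; first exact: coord_le_mx_norm.
  apply: (near_x _ _).2; rewrite /ball_/= opprD addrA subrr sub0r normrN.
  exact: le_lt_trans (wh i) had.
by rewrite sumr_const card_ord -mulr_natl mulrA.
Qed.

Lemma C2_is_derive Omega f x a : open Omega -> C2_on Omega f -> Omega x ->
  is_derive x a f (\sum_i a ord0 i * partial i f x).
Proof.
move=> Oopen f2 Ox; apply: is_derive_partials => [|i]; last by have [_ /(_ i)[_ []]] := f2 _ Ox.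
by apply: filterS (open_nbhs_nbhs (conj Oopen Ox)) => y /f2[_ fi] i; have [] := fi i.
Qed.

Lemma C2_is_derive_partial Omega f x a i : open Omega -> C2_on Omega f -> Omega x ->
  is_derive x a (partial i f) (\sum_j a ord0 j * partial j (partial i f) x).
Proof.
move=> Oopen f2 Ox; apply: is_derive_partials => [|j].
  apply: filterS (open_nbhs_nbhs (conj Oopen Ox)) => y /f2[_ /(_ i)[_ [_ fij]]] j.
  by have [] := fij j.
by have [_ /(_ i)[_ [_ /(_ j)[]]]] := f2 _ Ox.
Qed.

Lemma hessian_quadE f x a : (a *m hessian f x *m a^T) ord0 ord0 =
  \sum_i a ord0 i * (\sum_j a ord0 j * partial j (partial i f) x).
Proof.
rewrite mxE; under eq_bigr => j _ do rewrite !mxE mulr_suml.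
rewrite exchange_big/=; apply: eq_bigr => i _; rewrite mulr_sumr.
by apply: eq_bigr => j _; rewrite !mxE; ring.
Qed.

Lemma local_max_psd_opp_hessian Omega f x : open Omega -> C2_on Omega f -> Omega x ->
  (\forall y \near x, f y <= f x) -> psd (- hessian f x).
Proof.
move=> Oopen f2 Ox fmax a.
rewrite mulmxN mulNmx mxE oppr_ge0 hessian_quadE.
pose g (t : R) := f (x + t *: a); pose dg (t : R) := \sum_i a ord0 i * partial i f (x + t *: a).
apply: (@local_max_second_derive_le0 R g dg 0).
- have Oline : \forall t \near (0 : R), Omega (x + t *: a).
    by apply: cvg_line; exact: open_nbhs_nbhs.
  by apply: filterS Oline => t Ot; apply: is_derive_line; exact: C2_is_derive Oopen f2 Ot.
- rewrite (_ : dg = \sum_i (a ord0 i \*: (fun t => partial i f (x + t *: a)))); last first.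
    by apply/funext => t; rewrite fct_sumE.
  apply: is_derive_sum => i; apply: is_deriveZ; apply: is_derive_line.
  by rewrite scale0r addr0; exact: C2_is_derive_partial f2 Ox.
- have fmax_line : \forall t \near (0 : R), f (x + t *: a) <= f x by exact: cvg_line fmax.
  by apply: filterS fmax_line => t; rewrite /g scale0r addr0.
Qed.

Lemma mixed_increment f x (i j : 'I_n) (s : R) : 0 < s ->
  C2_on [set y | `|x - y| <= 2 * s] f ->
  exists2 z, `|x - z| <= 2 * s &
    f (x + s *: evec R i + s *: evec R j) - f (x + s *: evec R i) -
    (f (x + s *: evec R j) - f x) = s ^+ 2 * partial j (partial i f) z.
Proof.
move=> s0 f2; pose g y := f (y + s *: evec R j) - f y.
have close (p q : R) : `|p| <= s -> `|q| <= s ->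
    `|x - (x + p *: evec R i + q *: evec R j)| <= 2 * s.
  move=> ps qs; rewrite !opprD !addrA subrr sub0r -opprD normrN.
  rewrite (le_trans (ler_normD _ _))// !normrZ mulr_natl mulr2n.
  by rewrite lerD// -[leRHS]mulr1 ler_pM// norm_evec_le1.
have sr (r : R) : 0 <= r <= 1 -> `|s * r| <= s.
  by move=> /andP[r0 r1]; rewrite ger0_norm ?mulr_ge0 ?ler_piMr// ltW.
have sN : `|s| <= s by rewrite gtr0_norm.
have gd (p : R) : `|p| <= s -> is_derive (x + p *: evec R i) (evec R i) g
    (partial i f (x + p *: evec R i + s *: evec R j) - partial i f (x + p *: evec R i)).
  move=> ps; apply: is_deriveB; last apply: derivableP.
    by apply/is_derive_translate/derivableP; have [_ /(_ i)[]] := f2 _ (close p s ps sN).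
  have := close p 0 ps; rewrite scale0r addr0 normr0 => /(_ (ltW s0)) /f2[_ /(_ i)].
  by case.
have [r /sr/gd[]//|r /andP[/ltW r0 /ltW r1]] := @MVT_line R _ g x (evec R i) s.
have rs : `|s * r| <= s by apply: sr; rewrite r0.
have [_ ->] := gd _ rs => gE.
have [r' /sr r's|r' /andP[/ltW r'0 /ltW r'1] fE] :=
    @MVT_line R _ (partial i f) (x + (s * r) *: evec R i) (evec R j) s.
  by have [_ /(_ i)[_ [_ /(_ j)[]]]] := f2 _ (close _ _ rs r's).
exists (x + (s * r) *: evec R i + (s * r') *: evec R j).
  by apply: close => //; apply: sr; rewrite r'0.
by rewrite expr2 -mulrA -fE -gE.
Qed.

Lemma hessian_symmx Omega f x : open Omega -> C2_on Omega f -> Omega x ->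
  symmx (hessian f x).
Proof.
move=> Oopen f2 Ox; apply/matrixP => i j; rewrite !mxE.
apply/eqP; rewrite -subr_eq0 -normr_le0; apply/ler_addgt0Pr => e e0; rewrite add0r.
have cont k l : \forall y \near x,
    `|partial k (partial l f) x - partial k (partial l f) y| <= e / 2.
  have [_ /(_ l)[_ [_ /(_ k)[_]]]] := f2 _ Ox.
  by move=> /cvgrPdist_le; apply; rewrite divr_gt0.
have [d /= d0 near_x] := (nbhs_normP _ _).1
  (filterI (open_nbhs_nbhs (conj Oopen Ox)) (filterI (cont i j) (cont j i))).
pose s := d / 4; have s0 : 0 < s by rewrite divr_gt0.
have close y : `|x - y| <= 2 * s -> ball_ Num.norm x d y.
  by move=> ys; rewrite /ball_/= (le_lt_trans ys)// /s; lra.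
have f2s : C2_on [set y | `|x - y| <= 2 * s] f.
  by move=> y /close/near_x[Oy _]; exact: f2.
have [z1 /close/near_x[_ [_ z1_near]] incr_ij] := @mixed_increment f x i j s s0 f2s.
have [z2 /close/near_x[_ [z2_near _]] incr_ji] := @mixed_increment f x j i s s0 f2s.
have mixed_eq : partial j (partial i f) z1 = partial i (partial j f) z2.
  have s2 : s ^+ 2 != 0 by rewrite expf_neq0// gt_eqF.
  apply: (mulfI s2); apply: etrans (esym incr_ij) (etrans _ incr_ji); rewrite [x + _ + _]addrAC.
  by move: (f (x + _ + _)) (f (x + _)) (f (x + _)) (f x) => ? ? ? ?; ring.
rewrite [leRHS]splitr; apply: le_trans (ler_distD (partial i (partial j f) z2) _ _) _.
by apply: lerD; [exact: z2_near|rewrite -mixed_eq distrC; exact: z1_near].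
Qed.

End Partials.

(** * Separation from a superlevel set *)

Section SquaredNorm.
Context {R : realType}.

Definition dotv n (x y : 'rV[R]_n) : R := \sum_i x ord0 i * y ord0 i.
Definition sqnorm n (x : 'rV[R]_n) : R := \sum_i x ord0 i ^+ 2.
Definition sqdist n (z x : 'rV[R]_n) : R := sqnorm (x - z).
(* Indexed by the square of the radius. *)
Definition disc n (z : 'rV[R]_n) (c : R) : set 'rV[R]_n := [set x | sqdist z x <= c].

Lemma sqnorm_ge0 n (x : 'rV[R]_n) : 0 <= sqnorm x.
Proof. by apply: sumr_ge0 => i _; exact: sqr_ge0. Qed.

Lemma sqnorm0 n : sqnorm (0 : 'rV[R]_n) = 0.
Proof. by apply: big1 => i _; rewrite mxE expr0n. Qed.

Lemma sqnormD n (x y : 'rV[R]_n) (t : R) :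
  sqnorm (x + t *: y) = sqnorm x + 2 * t * dotv x y + t ^+ 2 * sqnorm y.
Proof.
rewrite /sqnorm /dotv !mulr_sumr -!big_split/=; apply: eq_bigr => i _.
by rewrite !mxE; ring.
Qed.

Lemma sqnormZ n (t : R) (x : 'rV[R]_n) : sqnorm (t *: x) = t ^+ 2 * sqnorm x.
Proof. by rewrite /sqnorm mulr_sumr; apply: eq_bigr => i _; rewrite mxE exprMn. Qed.

Lemma norm_le_sqnorm n (x : 'rV[R]_n) : `|x| ^+ 2 <= sqnorm x.
Proof.
have [->|x0] := eqVneq x 0; first by rewrite normr0 expr0n sqnorm_ge0.
have [[k j] ->] : exists ij, `|x| = `|x ij.1 ij.2|.
  by apply: mx_norm_neq0; rewrite -[mx_norm x]/(`|x|) normr_eq0.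
rewrite /= ord1 real_normK ?num_real// /sqnorm (bigD1 j)//= lerDl.
by apply: sumr_ge0 => i _; exact: sqr_ge0.
Qed.

Lemma sqnorm_eq0 n (x : 'rV[R]_n) : (sqnorm x == 0) = (x == 0).
Proof.
apply/idP/idP => [/eqP x0|/eqP->]; last by rewrite sqnorm0.
by have := norm_le_sqnorm x; rewrite x0 exprn_even_le0//= normr_eq0.
Qed.

Lemma continuous_sqdist n (z : 'rV[R]_n) : continuous (sqdist z).
Proof.
apply: (continuous_big add_continuous) => i _ x.
have coordB_cont : {for x, continuous (fun y : 'rV[R]_n => (y - z) ord0 i)}.
  rewrite (_ : (fun _ => _) = (fun y : 'rV[R]_n => y ord0 i) \- cst (z ord0 i)).
    by apply: continuousB; [exact: coord_continuous|exact: cst_continuous].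
  by apply/funext => y; rewrite !mxE.
exact: (continuousM coordB_cont coordB_cont).
Qed.

Lemma compact_disc n (z : 'rV[R]_n) (c : R) : compact (disc z c).
Proof.
apply: bounded_closed_compact; last first.
  rewrite (_ : disc z c = sqdist z @^-1` [set y | y <= c])//.
  by apply: closed_comp => [x _|]; [exact: continuous_sqdist|exact: closed_le].
exists (`|z| + Num.sqrt c); split; first exact: num_real.
move=> m mz x /= xc; apply: le_trans (ltW mz).
rewrite -[x](subrK z) addrC (le_trans (ler_normD _ _))// lerD2l.
have c0 : 0 <= c by exact: le_trans (sqnorm_ge0 _) xc.
rewrite -(@ler_pXn2r _ 2)// ?nnegrE ?sqrtr_ge0// sqr_sqrtr//.
exact: le_trans (norm_le_sqnorm _) xc.
Qed.

Lemma compact_sphere n (z : 'rV[R]_n) (c : R) : compact [set x | sqdist z x = c].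
Proof.
apply: (subclosed_compact _ (@compact_disc n z c)) => [|x <-]; last by rewrite /disc/=.
rewrite (_ : mkset _ = sqdist z @^-1` [set c])//.
by apply: closed_comp => [x _|]; [exact: continuous_sqdist|exact: closed_eq].
Qed.

End SquaredNorm.

Section ConvexSeparation.
Context {R : realType} {n : nat}.
Implicit Types (K : set 'rV[R]_n) (x y z p : 'rV[R]_n).

Lemma closest_point K z : closed K -> K !=set0 ->
  exists2 p, K p & forall x, K x -> sqdist z p <= sqdist z x.
Proof.
move=> Kcl [y0 Ky0]; pose K0 := disc z (sqdist z y0) `&` K.
have K0cpt : compact K0 by apply: compact_closedI => //; exact: compact_disc.
have [||p] := EVT_min_rV (f := sqdist z) _ K0cpt.
- by exists y0; split => //; rewrite /disc/=.
- by apply: continuous_subspaceT; exact: continuous_sqdist.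
rewrite inE => -[pz Kp] pmin; exists p => // x Kx.
have [xz|/ltW xz] := leP (sqdist z x) (sqdist z y0).
  by apply: pmin; rewrite inE.
exact: le_trans pz xz.
Qed.

Lemma closest_point_dotv_ge0 K z p : convex_set (K : set (convex_lmodType 'rV[R]_n)) ->
  K p -> (forall x, K x -> sqdist z p <= sqdist z x) ->
  forall y, K y -> 0 <= dotv (p - z) (y - p).
Proof.
move=> Kconv Kp pmin y Ky; rewrite leNgt; apply/negP.
set dot := dotv _ _ => dot0; pose len := sqnorm (y - p).
have len0 : 0 <= len by exact: sqnorm_ge0.
have gap0 : 0 < len - dot by lra.
pose t := - dot / (len - dot).
have t0 : 0 < t by rewrite divr_gt0// oppr_gt0.
have t1 : t <= 1 by rewrite ler_pdivrMr// mul1r lerDr.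
have := pmin (t *: y + (1 - t) *: p); rewrite /sqdist.
have -> : t *: y + (1 - t) *: p - z = p - z + t *: (y - p).
  by apply/rowP => i; rewrite !mxE; ring.
rewrite sqnormD -/dot -/len -addrA lerDl => pmin_t.
have : 0 <= t * (2 * dot + t * len).
  rewrite (_ : t * _ = 2 * t * dot + t ^+ 2 * len); last by ring.
  apply: pmin_t; rewrite -in_setE.
  by have := Kconv y p (Itv01 (ltW t0) t1); rewrite !in_setE; exact.
rewrite pmulr_rge0// => slope.
have : t * (len - dot) = - dot by rewrite /t divfK// gt_eqF.
by have := mulr_gt0 t0 gap0; nra.
Qed.

Lemma closed_convex_separation K z : closed K ->
  convex_set (K : set (convex_lmodType 'rV[R]_n)) -> K !=set0 -> ~ K z ->
  exists a c, dotv a z < c /\ forall y, K y -> c <= dotv a y.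
Proof.
move=> Kcl Kconv Kne Kz; have [p Kp pmin] := closest_point z Kcl Kne.
have dotvB a x y : dotv a (x - y) = dotv a x - dotv a y.
  by rewrite /dotv -sumrB; apply: eq_bigr => i _; rewrite !mxE mulrBr.
exists (p - z), (dotv (p - z) p); split=> [|y Ky]; last first.
  by rewrite -subr_ge0 -dotvB; exact: closest_point_dotv_ge0 pmin _ Ky.
rewrite -subr_gt0 -dotvB (_ : dotv _ _ = sqnorm (p - z)); last first.
  by apply: eq_bigr => i _; rewrite expr2.
rewrite lt_def sqnorm_ge0 andbT sqnorm_eq0 subr_eq0.
by apply/eqP => pz; apply: Kz; rewrite -pz.
Qed.

End ConvexSeparation.

Section SuperlevelSeparation.
Context {R : realType} {n : nat}.
Implicit Types (A M N : 'M[R]_n) (K : set 'M[R]_n).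

Lemma dotv_mxvec A M : dotv (mxvec A) (mxvec M) = \tr (A^T *m M).
Proof.
rewrite /dotv (reindex _ (curry_mxvec_bij n n))/=.
rewrite /mxtrace; under [RHS]eq_bigr => i _ do rewrite mxE.
rewrite exchange_big pair_big/=; apply: eq_bigr => -[i j] _ /=.
by rewrite !mxvecE mxE.
Qed.

Lemma continuous_vec_mx : continuous (@vec_mx R n n).
Proof.
move=> v s /nbhs_ballP[e e0 es]; apply/nbhs_ballP; exists e => // w [_ vw].
by apply: es; split => // i j; rewrite !mxE; exact: vw.
Qed.

Lemma closed_convex_separation_mx K M0 : closed K ->
  convex_set (K : set (convex_lmodType 'M[R]_n)) -> K !=set0 -> ~ K M0 ->
  exists A c, \tr (A *m M0) < c /\ forall M, K M -> c <= \tr (A *m M).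
Proof.
move=> Kcl Kconv [M KM] KM0.
have [||||a [c [aM0 aK]]] := @closed_convex_separation R _ (vec_mx @^-1` K) (mxvec M0).
- by apply: preimage_closed => // v _; exact: continuous_vec_mx.
- move=> x y t; rewrite !in_setE /= => Kx Ky; rewrite -in_setE linearD/= !linearZ/=.
  by apply: Kconv; rewrite in_setE.
- by exists (mxvec M); rewrite /= mxvecK.
- by rewrite /= mxvecK.
exists (vec_mx a)^T, c; rewrite -dotv_mxvec vec_mxK; split=> // N KN.
by rewrite -dotv_mxvec vec_mxK; apply: aK; rewrite /= mxvecK.
Qed.

Definition psd_dual A : Prop := forall N, symmx N -> psd N -> 0 <= \tr (A *m N).

Lemma psd_dual_of_lower_bound K A (c : R) : K !=set0 ->
  (forall M N, K M -> symmx N -> psd N -> K (M + N)) ->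
  (forall M, K M -> c <= \tr (A *m M)) -> psd_dual A.
Proof.
move=> [M KM] Kpsd AK N Ns Np; rewrite leNgt; apply/negP => AN.
pose t := (\tr (A *m M) - c + 1) / - \tr (A *m N).
have AM : 0 <= \tr (A *m M) - c by rewrite subr_ge0 AK.
have t0 : 0 <= t by rewrite divr_ge0; lra.
have tN : t * \tr (A *m N) = - (\tr (A *m M) - c + 1).
  by rewrite /t; field; rewrite lt_eqF.
have := AK (M + t *: N); rewrite mulmxDr mxtraceD -scalemxAr mxtraceZ tN.
suff KMN : K (M + t *: N) by move=> /(_ KMN); lra.
apply: Kpsd => // [|x]; first by rewrite /symmx linearZ/= Ns.
by rewrite -scalemxAr -scalemxAl mxE mulr_ge0.
Qed.

Lemma opnorm_ge0 N : 0 <= opnorm N.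
Proof.
have [supN|supN] := pselect (has_sup [set enorm (x *m N^T) | x in [set x | enorm x = 1]]).
  have [[y Ny] ub] := supN; apply: le_trans (ub_le_sup ub Ny).
  by case: Ny => x _ <-; exact: sqrtr_ge0.
by rewrite /opnorm sup_out.
Qed.

Lemma enormE (x : 'rV[R]_n) : enorm x = Num.sqrt (sqnorm x).
Proof. by []. Qed.

Lemma enormZ (t : R) (x : 'rV[R]_n) : enorm (t *: x) = `|t| * enorm x.
Proof. by rewrite !enormE sqnormZ sqrtrM ?sqr_ge0// sqrtr_sqr. Qed.

Lemma enorm_evec (i : 'I_n) : enorm (evec R i) = 1.
Proof.
rewrite enormE /sqnorm (bigD1 i)//= big1 => [|j /negbTE ji].
  by rewrite mxE !eqxx expr1n addr0 sqrtr1.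
by rewrite mxE ji andbF expr0n.
Qed.

Lemma opnorm_scalar (t : R) : (0 < n)%N -> 0 <= t -> opnorm (t%:M : 'M[R]_n) = t.
Proof.
move=> n0 t0; rewrite /opnorm (_ : [set _ | _ in _] = [set t]) ?sup1//.
have enorm_scalar (x : 'rV[R]_n) : enorm x = 1 -> enorm (x *m (t%:M)^T) = t.
  by move=> x1; rewrite tr_scalar_mx mul_mx_scalar enormZ x1 mulr1 ger0_norm.
apply/seteqP; split=> [_ [x x1 <-]|_ ->]; first exact: enorm_scalar.
by exists (evec R (Ordinal n0)); [|apply: enorm_scalar]; exact: enorm_evec.
Qed.

Lemma psd_scalar (t : R) : 0 <= t -> psd (t%:M : 'M[R]_n).
Proof.
move=> t0 x; rewrite mul_mx_scalar -scalemxAl mxE mulr_ge0// mxE sumr_ge0// => i _.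
by rewrite mxE -expr2 sqr_ge0.
Qed.

Lemma closed_symmx : closed [set M : 'M[R]_n | symmx M].
Proof.
move=> M Mcl; apply/matrixP => i j; rewrite mxE; apply/eqP; rewrite -subr_eq0; apply/eqP.
pose asym (N : 'M[R]_n) : R := N j i - N i j.
have asym_closed : closed (asym @^-1` [set 0]).
  apply: preimage_closed; last exact: closed_eq.
  by move=> N _; apply: continuousB; exact: coord_continuous.
by apply: asym_closed; apply: closure_subset Mcl => N Ns /=; rewrite /asym -{1}Ns mxE subrr.
Qed.

Variables (F : 'M[R]_n -> R) (lam Lam : R).
Hypothesis Fell : unif_elliptic F lam Lam.
Hypothesis Fcont : {within [set M | symmx M], continuous F}.
Hypothesis Fqc : quasiconcave F.

Definition superlevel : set 'M[R]_n := [set M | symmx M /\ 0 <= F M].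

Lemma closed_superlevel : closed superlevel.
Proof.
move/subspace_continuousP : Fcont => Fc M Mcl.
have Ms : symmx M by apply: closed_symmx; apply: closure_subset Mcl => N [].
split => //; rewrite leNgt; apply/negP => FM.
have : \forall N \near within [set M | symmx M] (nbhs M), F N < 0.
  by move: (Fc _ Ms) => /cvgr_lt; apply.
rewrite near_withinE => /Mcl[N [[Ns FN] /(_ Ns)]].
by rewrite ltNge FN.
Qed.

Lemma convex_superlevel : convex_set (superlevel : set (convex_lmodType 'M[R]_n)).
Proof.
move=> M N t; rewrite !in_setE => -[Ms FM] [Ns FN]; split.
  by rewrite /symmx linearD/= !linearZ/= Ms Ns.
apply: le_trans (Fqc Ms Ns (_ : 0 <= t%:num <= 1)); first by rewrite le_min FM.
by rewrite ge0 le1.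
Qed.

Lemma superlevelD_psd M N : superlevel M -> symmx N -> psd N -> superlevel (M + N).
Proof.
move=> [Ms FM] Ns Np; split; first by rewrite /symmx linearD/= Ms Ns.
have [lam0 [_ /(_ M N Ms Ns Np)[FMN _]]] := Fell.
have := le_trans (mulr_ge0 (ltW lam0) (opnorm_ge0 N)) FMN.
by rewrite subr_ge0; exact: le_trans.
Qed.

Lemma superlevelD_scalar M : (0 < n)%N -> symmx M -> F M < 0 ->
  exists2 t, 0 < t & superlevel (M + t%:M).
Proof.
move=> n0 Ms FM; have [lam0 [_ Flb]] := Fell; pose t := - F M / lam.
have t0 : 0 < t by rewrite divr_gt0// oppr_gt0.
exists t => //; split; first by rewrite /symmx linearD/= Ms tr_scalar_mx.
have [FMt _] := Flb M t%:M Ms (tr_scalar_mx _ _) (psd_scalar (ltW t0)).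
by move: FMt; rewrite opnorm_scalar ?(ltW t0)// /t mulrC divfK ?gt_eqF// lerBrDr addNr.
Qed.

Lemma superlevel_separation M0 : (0 < n)%N -> symmx M0 -> F M0 < 0 ->
  exists A c, [/\ psd_dual A, 0 < \tr A, \tr (A *m M0) < c &
    forall M, superlevel M -> c <= \tr (A *m M)].
Proof.
move=> n0 M0s FM0; have [t t0 FM0t] := superlevelD_scalar n0 M0s FM0.
have Fne : superlevel !=set0 by exists (M0 + t%:M).
have FM0' : ~ superlevel M0 by move=> [_]; rewrite leNgt FM0.
have [A [c [AM0 AF]]] := closed_convex_separation_mx closed_superlevel convex_superlevel Fne FM0'.
exists A, c; split => //; first exact: psd_dual_of_lower_bound Fne superlevelD_psd AF.
have := lt_le_trans AM0 (AF _ FM0t).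
by rewrite mulmxDr mxtraceD ltrDl mul_mx_scalar mxtraceZ pmulr_rgt0.
Qed.

End SuperlevelSeparation.

(** * Polynomial functions *)

Section FiniteDimension.
Context {K : fieldType} {V : lmodType K}.

Lemma spanned_linear_dependence (I : finType) (b : I -> V) N (f : 'I_N -> V) : (#|I| < N)%N ->
  (forall k, exists a : I -> K, f k = \sum_i a i *: b i) ->
  exists2 v : 'I_N -> K, exists k, v k != 0 & \sum_k v k *: f k = 0.
Proof.
move=> IN /choice[coef fE].
pose M : 'M[K]_(N, #|I|) := \matrix_(k, l) coef k (enum_val l).
have : kermx M != 0.
  by rewrite -mxrank_eq0 mxrank_ker subn_eq0 -ltnNge (leq_ltn_trans (rank_leq_col M)).
move=> /rowV0Pn[v /sub_kermxP vM v0]; exists (v ord0).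
  apply/existsP; apply: contraNT v0; rewrite negb_exists => /forallP v0.
  by apply/eqP/rowP => k; rewrite mxE; apply/eqP; rewrite -[_ == _]negbK.
under eq_bigr => k _ do rewrite fE scaler_sumr.
rewrite exchange_big big1// => i _ /=.
under eq_bigr => k _ do rewrite scalerA.
rewrite -scaler_suml (_ : \sum_k _ = (v *m M) ord0 (enum_rank i)).
  by rewrite vM mxE scale0r.
by rewrite mxE; apply: eq_bigr => k _; rewrite mxE enum_rankK.
Qed.

Variables (P : V -> Prop) (T : V -> V).
Hypothesis P0 : P 0.
Hypothesis P_lin : forall a f g, P f -> P g -> P (a *: f + g).
Hypothesis P_stable : forall f, P f -> P (T f).
Hypothesis T_lin : forall a f g, P f -> P g -> T (a *: f + g) = a *: T f + T g.
Hypothesis T_inj : forall f, P f -> T f = 0 -> f = 0.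

Let T0 : T 0 = 0.
Proof. by have := T_lin (-1) P0 P0; rewrite scaler0 addr0 scaleN1r addNr. Qed.

Let PZ a f : P f -> P (a *: f).
Proof. by move=> Pf; rewrite -[_ *: _]addr0; exact: P_lin. Qed.

Let P_sum N (a : nat -> K) (f : nat -> V) :
  (forall k, P (f k)) -> P (\sum_(k < N) a k *: f k).
Proof.
move=> Pf; elim: N => [|N IH]; first by rewrite big_ord0.
by rewrite big_ord_recr/= addrC; exact: P_lin.
Qed.

Let T_sum N (a : nat -> K) (f : nat -> V) : (forall k, P (f k)) ->
  T (\sum_(k < N) a k *: f k) = \sum_(k < N) a k *: T (f k).
Proof.
move=> Pf; elim: N => [|N IH]; first by rewrite !big_ord0.
by rewrite !big_ord_recr/= addrC T_lin ?IH 1?addrC//; exact: P_sum.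
Qed.

(* Injectivity cancels a factor [T] as long as the constant coefficient vanishes. *)
Lemma iter_relation_preimage N (a : nat -> K) g : P g ->
  (exists2 k, (k < N)%N & a k != 0) -> \sum_(k < N) a k *: iter k T g = 0 ->
  exists2 f, P f & T f = g.
Proof.
move=> Pg; have P_iter k : P (iter k T g) by elim: k => //= k; exact: P_stable.
elim: N a => [|N IH] a [k kN ak] //.
pose s := \sum_(k < N) a k.+1 *: iter k T g.
have Ps : P s by exact: (P_sum N (a \o S) P_iter).
have sT : T s = \sum_(k < N) a k.+1 *: iter k.+1 T g by exact: (T_sum N (a \o S) P_iter).
rewrite big_ord_recl/= -sT.
have [a0|a0] := eqVneq (a 0%N) 0.
  rewrite a0 scale0r add0r => /(T_inj Ps); apply: (IH (a \o S)).
  by case: k kN ak => [|k] kN ak; [rewrite a0 eqxx in ak|exists k].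
move=> /eqP; rewrite addrC addr_eq0 => /eqP Ts.
exists (- (a 0%N)^-1 *: s); first exact: PZ.
have := T_lin (- (a 0%N)^-1) Ps P0; rewrite T0 !addr0 => ->.
by rewrite Ts scaleNr scalerN opprK scalerA mulVf// scale1r.
Qed.

Lemma spanned_injective_surjective (I : finType) (b : I -> V) :
  (forall f, P f -> exists a : I -> K, f = \sum_i a i *: b i) ->
  forall g, P g -> exists2 f, P f & T f = g.
Proof.
move=> Pspan g Pg; have P_iter k : P (iter k T g) by elim: k => //= k; exact: P_stable.
have [||v [k vk] vT] := @spanned_linear_dependence I b #|I|.+1 (fun k => iter k T g).
- by [].
- by move=> k; exact: Pspan.
apply: (@iter_relation_preimage #|I|.+1 (fun k => v (inord k)) g Pg).
  by exists k => //; rewrite inord_val.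
by rewrite -[RHS]vT; apply: eq_bigr => l _; rewrite inord_val.
Qed.

End FiniteDimension.

Section PolynomialFunctions.
Context {R : realType} {n : nat}.
Implicit Types (f g : 'rV[R]_n -> R) (x y z : 'rV[R]_n).

Definition coordinate (i : 'I_n) : 'rV[R]_n -> R := fun x => x ord0 i.

(* As for [size] of a polynomial, [d] strictly bounds the degree. *)
Fixpoint polyfun d f : Prop :=
  if d is d'.+1 then
    exists c (g : 'I_n -> 'rV[R]_n -> R),
      (forall i, polyfun d' (g i)) /\ f = cst c + \sum_i coordinate i * g i
  else f = 0.

Lemma fct_scalerAr (a : R) f g : a *: (f * g) = f * (a *: g).
Proof. by apply/funext => x; exact: mulrCA. Qed.

Lemma polyfun0 d : polyfun d 0.
Proof.
elim: d => //= d IH; exists 0, (fun=> 0); split => //.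
by rewrite big1 ?addr0// => i _; rewrite mulr0.
Qed.

Lemma polyfun_cst d (c : R) : polyfun d.+1 (cst c).
Proof.
exists c, (fun=> 0); split=> [i|]; first exact: polyfun0.
by rewrite big1 ?addr0// => i _; rewrite mulr0.
Qed.

Lemma polyfun_lin d (a : R) f g : polyfun d f -> polyfun d g -> polyfun d (a *: f + g).
Proof.
elim: d f g => [|d IH] f g; first by move=> -> ->; rewrite scaler0 addr0.
move=> [cf [f' [Pf' ->]]] [cg [g' [Pg' ->]]].
exists (a * cf + cg), (fun i => a *: f' i + g' i); split=> [i|].
  exact: IH (Pf' i) (Pg' i).
rewrite scalerDr addrACA scaler_sumr -big_split; congr (_ + _).
by apply: eq_bigr => i _; rewrite mulrDr fct_scalerAr.
Qed.

Lemma polyfunD d f g : polyfun d f -> polyfun d g -> polyfun d (f + g).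
Proof. by rewrite -[f in f + g]scale1r; exact: polyfun_lin. Qed.

Lemma polyfunZ d (a : R) f : polyfun d f -> polyfun d (a *: f).
Proof. by rewrite -[a *: f]addr0 => Pf; apply: polyfun_lin => //; exact: polyfun0. Qed.

Lemma polyfun_sum d (I : Type) (r : seq I) (f : I -> 'rV[R]_n -> R) :
  (forall i, polyfun d (f i)) -> polyfun d (\sum_(i <- r) f i).
Proof.
move=> Pf; elim: r => [|i r IH]; first by rewrite big_nil; exact: polyfun0.
by rewrite big_cons; exact: polyfunD.
Qed.

Lemma polyfunS d f : polyfun d f -> polyfun d.+1 f.
Proof.
elim: d f => [|d IH] f; first by move=> ->; exact: polyfun0.
by move=> [c [g [Pg ->]]]; exists c, g; split => // i; exact: IH (Pg i).
Qed.

Lemma polyfun_coordinateM d f i : polyfun d.-1 f -> polyfun d (coordinate i * f).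
Proof.
case: d => [->|d Pf]; first by rewrite mulr0.
exists 0, (fun j => if j == i then f else 0); split=> [j|].
  by case: eqP => _ //; exact: polyfun0.
rewrite add0r (bigD1 i)//= eqxx big1 ?addr0// => j /negbTE ->.
by rewrite mulr0.
Qed.

Lemma continuous_polyfun d f : polyfun d f -> continuous f.
Proof.
elim: d f => [|d IH] f; first by move=> ->; exact: cst_continuous.
move=> [c [g [Pg ->]]] x; apply: continuousD; first exact: cst_continuous.
rewrite (_ : \sum_i _ = fun y => \sum_i (coordinate i * g i) y); last first.
  by apply/funext => y; rewrite fct_sumE.
apply: (continuous_big add_continuous) => i _ y.
by apply: continuousM; [exact: coord_continuous|exact: (IH _ (Pg i))].
Qed.

Lemma is_derive_coordinate x v i : is_derive x v (coordinate i) (v ord0 i).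
Proof.
have id_d : derivable (@id 'rV[R]_n) x v by exact: derivable_id.
split; first exact: (derivable_mxP _ _ _).1 id_d ord0 i.
by have := derive_mx id_d; rewrite derive_id => /rowP/(_ i); rewrite mxE.
Qed.

Lemma is_derive_polyfun d f i : polyfun d f ->
  exists2 g, polyfun d.-1 g & forall x, is_derive x (evec R i) f (g x).
Proof.
elim: d f => [|d IH] f.
  by move=> ->; exists 0 => // x; exact: is_derive_cst.
move=> [c [g [Pg ->]]].
have [g' Pg' gD] : exists2 g' : 'I_n -> 'rV[R]_n -> R, forall j, polyfun d.-1 (g' j) &
    forall j x, is_derive x (evec R i) (g j) (g' j x).
  have /choice[g' g'P] j : exists g', polyfun d.-1 g' /\
      forall x, is_derive x (evec R i) (g j) (g' x).
    by have [g' Pg' gD] := IH _ (Pg j); exists g'.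
  by exists g' => j; have [] := g'P j.
exists (g i + \sum_j coordinate j * g' j).
  apply: polyfunD; first exact: Pg.
  by apply: polyfun_sum => j; apply: polyfun_coordinateM; exact: Pg'.
move=> x; apply: is_derive_eq; first apply: is_deriveD.
  by apply: is_derive_sum => j; apply: is_deriveM; first exact: is_derive_coordinate.
rewrite add0r big_split/= addrC -[RHS]/(g i x + (\sum_j coordinate j * g' j) x) fct_sumE.
congr (_ + _); rewrite (bigD1 i)//= big1 => [|j ji]; rewrite mxE ?eqxx.
  by rewrite addr0 -[LHS]/(g i x * 1) mulr1.
by rewrite (negbTE ji) scaler0.
Qed.

Lemma derivable_polyfun d f x i : polyfun d f -> derivable f x (evec R i).
Proof. by move=> /(is_derive_polyfun i)[g _ /(_ x)[]]. Qed.

Lemma polyfun_partial d f i : polyfun d f -> polyfun d.-1 (partial i f).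
Proof.
move=> /(is_derive_polyfun i)[g Pg fD].
by rewrite (_ : partial i f = g)//; apply/funext => x; have [] := fD x.
Qed.

Lemma C2_on_polyfun d f (Omega : set 'rV[R]_n) : polyfun d f -> C2_on Omega f.
Proof.
move=> Pf x _; split; first exact: continuous_polyfun Pf x.
move=> i; have Pfi := polyfun_partial i Pf; split; first exact: derivable_polyfun Pf.
split=> [|j]; first exact: continuous_polyfun Pfi x.
split; first exact: derivable_polyfun Pfi.
exact: continuous_polyfun (polyfun_partial j Pfi) x.
Qed.

Lemma polyfun_span d : exists (I : finType) (b : I -> 'rV[R]_n -> R),
  forall f, polyfun d f -> exists a : I -> R, f = \sum_k a k *: b k.
Proof.
elim: d => [|d [I [b b_span]]].
  by exists void, (fun=> 0) => f ->; exists (fun=> 0); rewrite big1// => -[].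
exists (unit + 'I_n * I)%type,
  (fun k => match k with inl _ => cst 1 | inr (i, k) => coordinate i * b k end).
move=> f [c [g [Pg ->]]].
have [a gE] := choice (fun i => b_span _ (Pg i)).
exists (fun k => match k with inl _ => c | inr (i, k) => a i k end).
rewrite big_sumType; congr (_ + _).
  rewrite (bigD1 tt)//= big1 ?addr0 => [|[]//].
  by apply/funext => x; rewrite -[RHS]/(c * 1) mulr1.
under [LHS]eq_bigr => i _ do rewrite gE mulr_sumr.
by rewrite pair_big/=; apply: eq_bigr => -[i k] _; rewrite fct_scalerAr.
Qed.

Lemma polyfun_line d f x y : polyfun d f ->
  exists Q : {poly R}, forall t, f (x + t *: y) = Q.[t].
Proof.
elim: d f => [|d IH] f; first by move=> ->; exists 0 => t; rewrite horner0.
move=> [c [g [Pg ->]]].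
have [Q QE] := choice (fun i => IH _ (Pg i)).
exists (c%:P + \sum_i ((x ord0 i)%:P + y ord0 i *: 'X) * Q i) => t.
rewrite hornerD hornerC horner_sum -[LHS]/(c + (\sum_i _) _) fct_sumE; congr (_ + _).
apply: eq_bigr => i _; rewrite !hornerE -QE -[LHS]/((x + t *: y) ord0 i * _).
by rewrite !mxE [t * _]mulrC.
Qed.

Lemma poly_near_eq0 (Q : {poly R}) (a : R) : (\forall t \near a, Q.[t] = 0) -> Q = 0.
Proof.
move=> /nbhs_normP[e /= e0 Qe]; apply/eqP; apply: contraT => Q0.
pose rs := [seq a + e / k.+2%:R | k <- iota 0 (size Q)].
suff : (size rs < size Q)%N by rewrite size_map size_iota ltnn.
apply: max_poly_roots => //.
  apply/allP => _ /mapP[k _ ->]; apply/eqP/Qe.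
  rewrite /ball_/= opprD addNKr normrN gtr0_norm ?divr_gt0// ltr_pdivrMr//.
  by rewrite ltr_pMr// ltr1n.
rewrite map_inj_uniq ?iota_uniq// => k l /addrI/(mulfI (lt0r_neq0 e0))/invr_inj/eqP.
by rewrite eqr_nat => /eqP[].
Qed.

Lemma polyfun_near_eq0 d f z : polyfun d f -> (\forall x \near z, f x = 0) -> f = 0.
Proof.
move=> Pf fz; apply/funext => x; have [Q QE] := polyfun_line z (x - z) Pf.
have Q0 : Q = 0.
  have fline : \forall t \near (0 : R), f (z + t *: (x - z)) = 0 by exact: cvg_line fz.
  by apply: (@poly_near_eq0 _ 0); apply: filterS fline => t; rewrite QE.
by have := QE 1; rewrite Q0 horner0 scale1r subrKC.
Qed.

End PolynomialFunctions.

(** * Linear equations: comparison on discs *)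

Lemma near_eq_continuous_at (T U : topologicalType) (f g : T -> U) x :
  (\forall y \near x, f y = g y) -> {for x, continuous f} -> {for x, continuous g}.
Proof.
move=> fg fc; rewrite /prop_for /continuous_at -(nbhs_singleton fg).
exact: cvg_trans (near_eq_cvg fg) fc.
Qed.

Lemma within_open_continuous (T U : topologicalType) (A : set T) (f : T -> U) x :
  open A -> {within A, continuous f} -> A x -> {for x, continuous f}.
Proof. by move=> Aopen; rewrite continuous_open_subspace// => fc Ax; apply: fc; rewrite inE. Qed.

Section HessianLinear.
Context {R : realType} {n : nat}.
Implicit Types (f g : 'rV[R]_n -> R) (x y z : 'rV[R]_n) (Omega : set 'rV[R]_n).

Lemma C2_is_derive_lin Omega (a : R) f g x i : C2_on Omega f -> C2_on Omega g -> Omega x ->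
  is_derive x (evec R i) (a *: f + g) ((a *: partial i f + partial i g) x).
Proof.
move=> f2 g2 Ox; apply: is_deriveD; first apply: is_deriveZ; apply: derivableP.
  by have [_ /(_ i)[]] := f2 _ Ox.
by have [_ /(_ i)[]] := g2 _ Ox.
Qed.

Lemma C2_near_partial_lin Omega (a : R) f g x i : open Omega ->
  C2_on Omega f -> C2_on Omega g -> Omega x ->
  \forall y \near x, (a *: partial i f + partial i g) y = partial i (a *: f + g) y.
Proof.
move=> Oopen f2 g2 Ox; apply: filterS (open_nbhs_nbhs (conj Oopen Ox)) => y Oy.
by have [_] := C2_is_derive_lin a i f2 g2 Oy.
Qed.

Lemma C2_is_derive_partial_lin Omega (a : R) f g x i j : open Omega ->
  C2_on Omega f -> C2_on Omega g -> Omega x ->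
  is_derive x (evec R j) (partial i (a *: f + g))
    ((a *: partial j (partial i f) + partial j (partial i g)) x).
Proof.
move=> Oopen f2 g2 Ox; apply: (near_eq_is_derive (C2_near_partial_lin a i Oopen f2 g2 Ox)).
apply: is_deriveD; first apply: is_deriveZ; apply: derivableP.
  by have [_ /(_ i)[_ [_ /(_ j)[]]]] := f2 _ Ox.
by have [_ /(_ i)[_ [_ /(_ j)[]]]] := g2 _ Ox.
Qed.

Lemma C2_on_lin Omega (a : R) f g : open Omega ->
  C2_on Omega f -> C2_on Omega g -> C2_on Omega (a *: f + g).
Proof.
have cont_lin p q x : {for x, continuous p} -> {for x, continuous q} ->
    {for x, continuous (a *: p + q : 'rV[R]_n -> R)}.
  move=> pc qc; apply: continuousD; last exact: qc.
  by apply: (@continuousM _ _ (cst a) p) pc; exact: cst_continuous.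
move=> Oopen f2 g2 x Ox; have [fc f'] := f2 _ Ox; have [gc g'] := g2 _ Ox.
split=> [|i]; first exact: cont_lin fc gc.
have [_ [f'c f'']] := f' i; have [_ [g'c g'']] := g' i.
split; first by have [] := C2_is_derive_lin a i f2 g2 Ox.
split=> [|j].
  exact: near_eq_continuous_at (C2_near_partial_lin a i Oopen f2 g2 Ox) (cont_lin _ _ _ f'c g'c).
split; first by have [] := C2_is_derive_partial_lin a i j Oopen f2 g2 Ox.
apply: (@near_eq_continuous_at _ _ (a *: partial j (partial i f) + partial j (partial i g))).
  apply: filterS (open_nbhs_nbhs (conj Oopen Ox)) => y Oy.
  by have [_] := C2_is_derive_partial_lin a i j Oopen f2 g2 Oy.
by apply: cont_lin; [have [] := f'' j|have [] := g'' j].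
Qed.

Lemma C2_onZ Omega (a : R) f : open Omega -> C2_on Omega f -> C2_on Omega (a *: f).
Proof.
by move=> Oopen f2; rewrite -[a](subrK 1) scalerDl scale1r; exact: C2_on_lin.
Qed.

Lemma hessian_lin Omega (a : R) f g x : open Omega ->
  C2_on Omega f -> C2_on Omega g -> Omega x ->
  hessian (a *: f + g) x = a *: hessian f x + hessian g x.
Proof.
move=> Oopen f2 g2 Ox; have hessianE h i j : hessian h x i j = partial j (partial i h) x.
  by rewrite mxE.
have linE (M N : 'M[R]_n) i j : (a *: M + N) i j = a * M i j + N i j by rewrite !mxE.
apply/matrixP => i j; rewrite linE.
have [_ partial2E] := C2_is_derive_partial_lin a i j Oopen f2 g2 Ox.
apply: etrans (hessianE _ i j) (etrans partial2E _).
exact/esym/(congr2 (fun s t => a * s + t) (hessianE f i j) (hessianE g i j)).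
Qed.

Lemma sqdistE z :
  sqdist z = \sum_i (coordinate i - cst (z ord0 i)) * (coordinate i - cst (z ord0 i)).
Proof.
apply/funext => x; rewrite fct_sumE; apply: eq_bigr => i _.
by rewrite !mxE expr2.
Qed.

Lemma polyfun_coordinateBM d f i (c : R) :
  polyfun d f -> polyfun d.+1 ((coordinate i - cst c) * f).
Proof.
move=> Pf; rewrite (_ : _ * f = (- c) *: f + coordinate i * f).
  by apply: polyfun_lin; [exact: polyfunS|exact: polyfun_coordinateM].
by rewrite mulrBl addrC; congr (_ + _); apply/funext => x; rewrite scaleNr.
Qed.

Lemma polyfun_sqdistM d f z : polyfun d f -> polyfun d.+2 (sqdist z * f).
Proof.
move=> Pf; rewrite sqdistE mulr_suml; apply: polyfun_sum => i; rewrite -mulrA.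
by do 2 apply: polyfun_coordinateBM.
Qed.

Lemma polyfun_sqdist z : polyfun 3 (sqdist z).
Proof. by rewrite -[sqdist z]mulr1; apply/polyfun_sqdistM/polyfun_cst. Qed.

Lemma C2_on_sqdist Omega z : C2_on Omega (sqdist z).
Proof. exact: C2_on_polyfun (polyfun_sqdist z). Qed.

Lemma partial_sqdist z i : partial i (sqdist z) = 2 *: (coordinate i - cst (z ord0 i)).
Proof.
apply/funext => x; rewrite sqdistE /partial.
have [_ ->] : is_derive x (evec R i)
    (\sum_j (coordinate j - cst (z ord0 j)) * (coordinate j - cst (z ord0 j)))
    (\sum_j 2 * (x ord0 j - z ord0 j) * (j == i)%:R).
  apply: is_derive_sum => j; have dj := is_derive_coordinate x (evec R i) j.
  apply: is_derive_eq; rewrite mxE eqxx subr0.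
  by rewrite -[_ *: _]/((x ord0 j - z ord0 j) * (j == i)%:R); ring.
rewrite (bigD1 i)//= eqxx big1 => [|j /negbTE ->]; last exact: mulr0.
by rewrite addr0 mulr1.
Qed.

Lemma hessian_sqdist z x : hessian (sqdist z) x = 2%:M.
Proof.
apply/matrixP => i j; rewrite !mxE partial_sqdist /partial.
have di := is_derive_coordinate x (evec R j) i.
have [_ ->] : is_derive x (evec R j) (2 *: (coordinate i - cst (z ord0 i))) (2 * (i == j)%:R).
  by apply: is_derive_eq; rewrite mxE eqxx subr0.
by rewrite mulr_natr.
Qed.

End HessianLinear.

Section TraceHessian.
Context {R : realType} {n : nat}.
Variable A : 'M[R]_n.
Implicit Types (f g : 'rV[R]_n -> R) (x z : 'rV[R]_n) (Omega : set 'rV[R]_n).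

Definition trhess f x : R := \tr (A *m hessian f x).

Lemma trhess_lin Omega (a : R) f g x : open Omega -> C2_on Omega f -> C2_on Omega g ->
  Omega x -> trhess (a *: f + g) x = a * trhess f x + trhess g x.
Proof.
move=> Oopen f2 g2 Ox; rewrite /trhess (hessian_lin a Oopen f2 g2 Ox).
by rewrite mulmxDr mxtraceD -scalemxAr mxtraceZ.
Qed.

Lemma trhessZ Omega (a : R) f x : open Omega -> C2_on Omega f -> Omega x ->
  trhess (a *: f) x = a * trhess f x.
Proof.
move=> Oopen f2 Ox; rewrite -[in LHS](subrK 1 a) scalerDl scale1r (trhess_lin _ Oopen f2 f2 Ox).
by ring.
Qed.

Lemma trhess_sqdist z x : trhess (sqdist z) x = 2 * \tr A.
Proof. by rewrite /trhess hessian_sqdist mul_mx_scalar mxtraceZ. Qed.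

Lemma trhessE f x : trhess f x = \sum_i \sum_k A i k * partial i (partial k f) x.
Proof. by apply: eq_bigr => i _; rewrite mxE; apply: eq_bigr => k _; rewrite mxE. Qed.

Lemma continuous_trhess Omega f x : C2_on Omega f -> Omega x -> {for x, continuous (trhess f)}.
Proof.
move=> f2 Ox; rewrite (_ : trhess f = fun y => \sum_i \sum_k A i k * partial i (partial k f) y).
  apply: (cvg_big add_continuous (@nbhs_filter _ x)) => i _.
  apply: (cvg_big add_continuous (@nbhs_filter _ x)) => k _.
  apply: (@continuousM _ _ (cst (A i k))); first exact: cst_continuous.
  by have [_ /(_ k)[_ [_ /(_ i)[]]]] := f2 _ Ox.
by apply/funext => y; exact: trhessE.
Qed.

Lemma polyfun_trhess d f : polyfun d f -> polyfun d.-2 (trhess f).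
Proof.
move=> Pf; rewrite (_ : trhess f = \sum_i \sum_k A i k *: partial i (partial k f)).
  apply: polyfun_sum => i; apply: polyfun_sum => k; apply: polyfunZ.
  by do 2 apply: polyfun_partial.
apply/funext => y; rewrite trhessE fct_sumE; apply: eq_bigr => i _.
by rewrite fct_sumE.
Qed.

End TraceHessian.

(* Otherwise unification unfolds [trhess] down to limits of difference quotients. *)
#[local] Opaque trhess.

Section LinearEquation.
Context {R : realType} {n : nat}.
Variable A : 'M[R]_n.
Implicit Types (f g h w phi psi : 'rV[R]_n -> R) (x y z : 'rV[R]_n).
Implicit Types (Omega : set 'rV[R]_n) (c k m r : R).

Definition lineq c (M : 'M[R]_n) : R := \tr (A *m M) - c.

Lemma lineq_hessian c f x : lineq c (hessian f x) = trhess A f x - c.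
Proof. by []. Qed.

Definition disc_comparison c Omega w := forall k z r m psi, k < c -> C2_on Omega psi ->
  disc z r `<=` Omega -> (forall x, disc z r x -> trhess A psi x <= k) ->
  (forall x, sqdist z x = r -> w x - psi x <= m) ->
  forall x, disc z r x -> w x - psi x <= m.

Lemma near_disc z r x : sqdist z x < r -> \forall y \near x, disc z r y.
Proof.
move=> xr; have : \forall y \near x, sqdist z y < r.
  by move: (@continuous_sqdist R n z x) => /cvgr_lt; apply.
by apply: filterS => y /ltW.
Qed.

Lemma near_sub_disc z (P : 'rV[R]_n -> Prop) : (\forall x \near z, P x) ->
  exists2 r, 0 < r & disc z r `<=` P.
Proof.
move=> /nbhs_normP[d /= d0 dP]; exists ((d / 2) ^+ 2); first by rewrite exprn_gt0// divr_gt0.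
move=> x xr; apply: dP; rewrite /ball_/= distrC; apply: (@le_lt_trans _ _ (d / 2)); last by lra.
rewrite -(@ler_pXn2r _ 2)// ?nnegrE//; last by lra.
exact: le_trans (norm_le_sqnorm _) xr.
Qed.

Lemma visc_subsol_disc_comparison c Omega w : open Omega ->
  visc_subsol (lineq c) Omega w -> disc_comparison c Omega w.
Proof.
move=> Oopen [wc wsub] k z r m psi kc psi2 disc_sub psik w_sphere x xr.
have [||p] := EVT_max_rV (f := w - psi) _ (@compact_disc R n z r).
- by exists x.
- apply: continuous_in_subspaceT => y /set_mem /disc_sub Oy; apply: continuousB.
    exact: within_open_continuous wc Oy.
  by have [] := psi2 _ Oy.
rewrite inE => pr pmax.
apply: (@le_trans _ _ (w p - psi p)); first by apply: (pmax x); rewrite inE.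
have [pe|pe] := eqVneq (sqdist z p) r; first exact: w_sphere.
suff : 0 <= lineq c (hessian psi p).
  rewrite lineq_hessian subr_ge0 => /(lt_le_trans kc).
  by rewrite ltNge psik.
apply: wsub => //; first exact: disc_sub.
have : \forall y \near p, disc z r y by apply: near_disc; rewrite lt_neqAle pe.
by apply: filterS => y yr; apply: (pmax y); rewrite inE.
Qed.

Lemma disc_comparison_visc_subsol c Omega w : open Omega -> 0 < \tr A ->
  {within Omega, continuous w} -> disc_comparison c Omega w -> visc_subsol (lineq c) Omega w.
Proof.
move=> Oopen A0 wc w_comp; split=> // phi z phi2 Oz touch.
rewrite lineq_hessian subr_ge0 leNgt; apply/negP => phic.
have [k [phik kc]] : exists k, trhess A phi z < k /\ k < c.
  by exists ((trhess A phi z + c) / 2); split; rewrite midf_lt.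
have [eta eta0 eta_lt] : exists2 eta, 0 < eta & eta * (2 * \tr A) + trhess A phi z < k.
  exists ((k - trhess A phi z) / (4 * \tr A)); first by rewrite divr_gt0 ?mulr_gt0// subr_gt0.
  move: (trhess A phi z) phik => a ak.
  by rewrite [X in X + _](_ : _ = (k - a) / 2); [lra|field; rewrite gt_eqF].
pose psi := eta *: sqdist z + phi.
have psi2 : C2_on Omega psi by exact: (C2_on_lin eta Oopen (C2_on_sqdist z) phi2).
have psi_near : \forall x \near z, trhess A psi x < k.
  have psiz : trhess A psi z < k.
    by rewrite /psi (trhess_lin _ _ Oopen (C2_on_sqdist z) phi2 Oz) trhess_sqdist.
  by move: (continuous_trhess (A := A) psi2 Oz) => /cvgr_lt; apply.
have [r r0 discP] := near_sub_disc
  (filterI (open_nbhs_nbhs (conj Oopen Oz)) (filterI psi_near touch)).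
have zz : sqdist z z = 0 by rewrite /sqdist subrr sqnorm0.
have psi_sphere x : sqdist z x = r -> w x - psi x <= w z - phi z - eta * r.
  move=> xr; have /discP[_ [_]] : disc z r x by rewrite /disc/= xr.
  by rewrite -[psi x]/(eta * sqdist z x + phi x) xr opprD addrA addrAC lerD2r.
have : w z - psi z <= w z - phi z - eta * r.
  apply: (w_comp _ _ _ _ _ kc psi2 _ _ psi_sphere) => [x /discP[]//|x /discP[_ [/ltW]]//|].
  by rewrite /disc/= zz ltW.
by rewrite -[psi z]/(eta * sqdist z z + phi z) zz mulr0 add0r leNgt gtrBl mulr_gt0.
Qed.

Hypothesis A_dual : psd_dual A.

Lemma C2_visc_subsol c Omega f : open Omega -> C2_on Omega f ->
  (forall x, Omega x -> c <= trhess A f x) -> visc_subsol (lineq c) Omega f.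
Proof.
move=> Oopen f2 fc; split=> [|phi z phi2 Oz touch].
  by apply: continuous_in_subspaceT => x /set_mem/f2[].
pose diff := -1 *: phi + f; have diff2 : C2_on Omega diff by exact: (C2_on_lin _ Oopen phi2 f2).
have diff_max : \forall y \near z, diff y <= diff z.
  apply: filterS touch => y.
  by rewrite -[diff y]/(-1 * phi y + f y) -[diff z]/(-1 * phi z + f z); lra.
rewrite lineq_hessian subr_ge0; apply: le_trans (fc _ Oz) _.
have : 0 <= \tr (A *m - hessian diff z).
  apply: A_dual; last exact: local_max_psd_opp_hessian Oopen diff2 Oz diff_max.
  by rewrite /symmx raddfN/= (hessian_symmx Oopen diff2 Oz).
rewrite mulmxN raddfN/= oppr_ge0 -[\tr _]/(trhess A diff z) /diff.
by rewrite (trhess_lin A _ Oopen phi2 f2 Oz) mulN1r addrC subr_le0.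
Qed.

Hypothesis A_gt0 : 0 < \tr A.

Lemma weak_max_principle Omega f z r m : open Omega -> C2_on Omega f ->
  disc z r `<=` Omega -> (forall x, Omega x -> 0 <= trhess A f x) ->
  (forall x, sqdist z x = r -> f x <= m) -> forall x, disc z r x -> f x <= m.
Proof.
move=> Oopen f2 disc_sub f_ge0 f_sphere x xr; apply/ler_addgt0Pr => e e0.
pose eta := e / (`|r| + 1); have eta0 : 0 < eta by rewrite divr_gt0// ltr_wpDl.
have eta_r : eta * r <= e.
  by rewrite /eta mulrAC ler_pdivrMr ?ltr_wpDl// ler_pM2l//; have := ler_norm r; lra.
have s2 := @C2_on_sqdist R n Omega z.
have := visc_subsol_disc_comparison Oopen (C2_visc_subsol Oopen f2 f_ge0).
move=> /(_ (- eta * (2 * \tr A)) z r (m + e) (- eta *: sqdist z)) comp.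
have : f x - (- eta * sqdist z x) <= m + e.
  apply: (comp _ _ disc_sub _ _ _ xr) => [||y /disc_sub Oy|y yr].
  - by rewrite mulNr oppr_lt0 mulr_gt0// mulr_gt0.
  - exact: (C2_onZ _ Oopen s2).
  - by rewrite (trhessZ _ _ Oopen s2 Oy) trhess_sqdist.
  - rewrite -[(_ *: _) y]/(- eta * sqdist z y) yr mulNr opprK.
    by rewrite lerD// f_sphere.
by have := mulr_ge0 (ltW eta0) (sqnorm_ge0 (x - z)); rewrite /sqdist; lra.
Qed.

Lemma polyfun_harmonic_eq0 d q z r : polyfun d q -> (forall x, trhess A q x = 0) ->
  (forall x, sqdist z x = r -> q x = 0) -> forall x, disc z r x -> q x = 0.
Proof.
move=> Pq Aq q_sphere x xr; have q2 : C2_on setT q by exact: C2_on_polyfun Pq.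
apply/eqP; rewrite eq_le; apply/andP; split.
  apply: (weak_max_principle openT q2) xr => // [y _|y yr]; first by rewrite Aq.
  by rewrite q_sphere.
rewrite -oppr_le0 -mulN1r.
apply: (weak_max_principle openT (C2_onZ (- 1) openT q2)) xr => // [y _|y yr].
  by rewrite (trhessZ _ _ openT q2)// Aq mulr0.
by rewrite -[(_ *: _) y]/(- 1 * q y) q_sphere// mulr0.
Qed.

Definition disc_weight z r : 'rV[R]_n -> R := cst r - sqdist z.

Lemma disc_weightM_sphere z r p x : sqdist z x = r -> (disc_weight z r * p) x = 0.
Proof. by move=> xr; rewrite -[LHS]/((r - sqdist z x) * p x) xr subrr mul0r. Qed.

Lemma polyfun_disc_weightM d z r p : polyfun d p -> polyfun d.+2 (disc_weight z r * p).
Proof.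
move=> Pp; rewrite (_ : _ * p = -1 *: (sqdist z * p) + r *: p).
  by apply: polyfun_lin; [exact: polyfun_sqdistM|do 2 apply: polyfunS; exact: polyfunZ].
by rewrite mulrBl addrC scaleN1r.
Qed.

Lemma trhess_disc_weightM_inj d z r p : 0 < r -> polyfun d p ->
  trhess A (disc_weight z r * p) = 0 -> p = 0.
Proof.
move=> r0 Pp Ap; apply: (polyfun_near_eq0 (z := z) Pp).
have weight_p_eq0 x : disc z r x -> (disc_weight z r * p) x = 0.
  apply: (polyfun_harmonic_eq0 (polyfun_disc_weightM z r Pp)) => [y|]; first by rewrite Ap.
  exact: disc_weightM_sphere.
have near_lt_r : \forall x \near z, sqdist z x < r.
  move: (@continuous_sqdist R n z z) => /cvgr_lt; apply.
  by rewrite /sqdist subrr sqnorm0.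
apply: filterS near_lt_r => x xr; apply/eqP; have /eqP := weight_p_eq0 x (ltW xr).
by rewrite -[(_ * p) x]/((r - sqdist z x) * p x) mulf_eq0 subr_eq0 gt_eqF.
Qed.

Lemma trhess_disc_weightM_surj d z r q : 0 < r -> polyfun d q ->
  exists2 p, polyfun d p & trhess A (disc_weight z r * p) = q.
Proof.
move=> r0 Pq; have [J [b b_span]] := @polyfun_span R n d.
pose T p := trhess A (disc_weight z r * p).
have PT p : polyfun d p -> polyfun d (T p).
  by move=> /(polyfun_disc_weightM z r); exact: polyfun_trhess.
have T_lin a f g : polyfun d f -> polyfun d g -> T (a *: f + g) = a *: T f + T g.
  have C2_weightM p : polyfun d p -> C2_on setT (disc_weight z r * p).
    by move=> /(polyfun_disc_weightM z r); exact: C2_on_polyfun.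
  move=> /C2_weightM f2 /C2_weightM g2.
  apply/funext => x; rewrite /T mulrDr -fct_scalerAr.
  exact: (trhess_lin A a openT f2 g2 I).
apply: (spanned_injective_surjective (polyfun0 _) (@polyfun_lin _ _ _) PT T_lin _ b_span Pq).
by move=> p; exact: trhess_disc_weightM_inj.
Qed.

Lemma polynomial_dirichlet d g z r k : 0 < r -> polyfun d.+1 g ->
  exists h, [/\ polyfun d.+3 h, forall x, trhess A h x = k &
    forall x, sqdist z x = r -> h x = g x].
Proof.
move=> r0 Pg; have Pg3 : polyfun d.+3 g by do 2 apply: polyfunS.
have [p /(polyfun_disc_weightM z r) Pp Ap] : exists2 p, polyfun d.+1 p &
    trhess A (disc_weight z r * p) = -1 *: trhess A g + cst k.
  apply: trhess_disc_weightM_surj => //.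
  by apply: polyfun_lin; [exact: polyfun_trhess Pg3|exact: polyfun_cst].
exists (1 *: (disc_weight z r * p) + g); split=> [|x|x xr].
- exact: polyfun_lin.
- rewrite (trhess_lin A 1 openT (C2_on_polyfun Pp) (C2_on_polyfun Pg3) I) Ap mul1r.
  by rewrite -[LHS]/(-1 * trhess A g x + k + _); ring.
- by rewrite -[LHS]/(1 * (_ * p) x + g x) disc_weightM_sphere// mulr0 add0r.
Qed.

End LinearEquation.

(** * Weierstrass approximation *)

Section RandomWalk.
Context {R : realType} {n : nat} {J : finType}.
Variables (prob : J -> R) (step : J -> 'rV[R]_n).
Implicit Types (f g : 'rV[R]_n -> R) (s x t : 'rV[R]_n).

(* Expectation of [f] after [k] independent steps from [s]. *)
Fixpoint walk k f s : R :=
  if k is k'.+1 then \sum_o prob o * walk k' f (s + step o) else f s.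

Lemma walkN k f s : walk k (- f) s = - walk k f s.
Proof.
elim: k s => //= k IH s; rewrite -sumrN; apply: eq_bigr => o _.
by rewrite IH mulrN.
Qed.

Hypothesis prob_ge0 : forall o, 0 <= prob o.
Hypothesis prob_sum1 : \sum_o prob o = 1.

Lemma walk_le k f g s : (forall y, f y <= g y) -> walk k f s <= walk k g s.
Proof.
move=> fg; elim: k s => [|k IH] s /=; first exact: fg.
by apply: ler_sum => o _; rewrite ler_wpM2l.
Qed.

Variables (w : 'rV[R]_n) (V : R).
Hypothesis step_mean : \sum_o prob o *: step o = w.
Hypothesis step_var : \sum_o prob o * sqnorm (step o) <= V.

Lemma step_sqnorm_le t : \sum_o prob o * sqnorm (t + step o) <= sqnorm (t + w) + V.
Proof.
have dot_mean : \sum_o prob o * dotv t (step o) = dotv t w.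
  rewrite -step_mean /dotv; under eq_bigr => o _ do rewrite mulr_sumr.
  rewrite exchange_big; apply: eq_bigr => i _ /=; rewrite summxE mulr_sumr.
  by apply: eq_bigr => o _; rewrite mxE mulrCA.
have sqnormE (y : 'rV[R]_n) : sqnorm (t + y) = sqnorm t + 2 * dotv t y + sqnorm y.
  by rewrite -[y in LHS]scale1r sqnormD mulr1 expr1n mul1r.
under eq_bigr => o _ do rewrite sqnormE mulrDr.
rewrite big_split lerD//= sqnormE -dot_mean.
under eq_bigr => o _ do rewrite mulrDr mulrCA.
by rewrite big_split/= -mulr_suml prob_sum1 mul1r -mulr_sumr lerDl sqnorm_ge0.
Qed.

Lemma walk_sqdist_le k x s (a C : R) : 0 <= C ->
  walk k (fun y => a + C * sqdist x y) s <=
  a + C * (sqnorm (s - x + k%:R *: w) + k%:R * V).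
Proof.
move=> C0; elim: k s => [|k IH] s; first by rewrite scale0r mul0r !addr0.
pose t := s - x + k%:R *: w.
have -> : s - x + k.+1%:R *: w = t + w by rewrite /t mulrSr scalerDl scale1r addrA.
apply: (@le_trans _ _ (\sum_o prob o * (a + C * (sqnorm (t + step o) + k%:R * V)))).
  apply: ler_sum => o _; rewrite ler_wpM2l// (le_trans (IH _))//.
  by rewrite /t [s + _ - x]addrAC [X in sqnorm X]addrAC.
have -> : \sum_o prob o * (a + C * (sqnorm (t + step o) + k%:R * V)) =
    a + C * (\sum_o prob o * sqnorm (t + step o) + k%:R * V).
  rewrite -[in RHS](mul1r a) -[in RHS](mul1r (k%:R * V)) -!prob_sum1 !mulr_suml -big_split/=.
  rewrite mulr_sumr -big_split/=; apply: eq_bigr => o _; ring.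
by rewrite lerD2l ler_wpM2l// mulrSr mulrDl mul1r addrCA [leLHS]addrC lerD2l step_sqnorm_le.
Qed.

Lemma walk_approx k f s x (e C : R) : 0 <= C ->
  (forall y, `|f y - f x| <= e + C * sqdist x y) ->
  `|walk k f s - f x| <= e + C * (sqnorm (s - x + k%:R *: w) + k%:R * V).
Proof.
move=> C0 f_mod; set B := C * _.
have walk_ub g : (forall y, g y <= g x + e + C * sqdist x y) -> walk k g s <= g x + e + B.
  by move=> g_le; apply: le_trans (walk_le k s g_le) (walk_sqdist_le k x s _ C0).
rewrite ler_distl; apply/andP; split; last first.
  by rewrite addrA; apply: walk_ub => y; have := f_mod y; rewrite ler_distl -addrA => /andP[].
have : walk k (- f) s <= (- f) x + e + B.
  apply: walk_ub => y; have := f_mod y; rewrite ler_distl -addrA => /andP[fy _].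
  by rewrite lerNl opprD opprK.
by rewrite walkN -addrA lerNl opprD opprK.
Qed.

End RandomWalk.

(* The probabilities are affine in the mean displacement [x], so that expectations are
   polynomial in [x], as for Bernstein polynomials. *)
Section CrossWalk.
Context {R : realType} {n : nat}.
Implicit Types (f : 'rV[R]_n -> R) (s x : 'rV[R]_n) (o : 'I_n * bool).
Variables (r h : R).
Hypothesis r_gt0 : 0 < r.

Definition cross_prob x o : R := (1 + (-1) ^+ o.2 * (x ord0 o.1 / r)) / (2 * n%:R).
Definition cross_step o : 'rV[R]_n := ((-1) ^+ o.2 * h) *: evec R o.1.

Lemma cross_prob_ge0 x o : `|x| <= r -> 0 <= cross_prob x o.
Proof.
move=> xr; rewrite divr_ge0 ?mulr_ge0 ?ler0n//.
have : `|x ord0 o.1 / r| <= 1.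
  rewrite normrM normfV (gtr0_norm r_gt0) ler_pdivrMr// mul1r.
  exact: le_trans (coord_le_mx_norm x ord0 o.1) xr.
by rewrite ler_norml; case: o.2; rewrite ?expr0 ?expr1; lra.
Qed.

Hypothesis n_gt0 : (0 < n)%N.
Let n_neq0 : n%:R != 0 :> R. Proof. by rewrite pnatr_eq0 -lt0n. Qed.
Let r_neq0 : r != 0. Proof. by rewrite gt_eqF. Qed.

Lemma cross_prob_sum1 x : \sum_o cross_prob x o = 1.
Proof.
rewrite -(pair_bigA _ (fun i b => cross_prob x (i, b)))/=.
transitivity (\sum_(i < n) (n%:R^-1 : R)).
  by apply: eq_bigr => i _; rewrite big_bool /cross_prob/=; field; rewrite n_neq0.
by rewrite sumr_const card_ord -[LHS]mulr_natr mulVf.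
Qed.

Lemma cross_step_mean x : \sum_o cross_prob x o *: cross_step o = (h / (n%:R * r)) *: x.
Proof.
rewrite -(pair_bigA _ (fun i b => cross_prob x (i, b) *: cross_step (i, b)))/=.
rewrite [x in RHS]row_sum_delta scaler_sumr; apply: eq_bigr => i _.
rewrite big_bool /cross_prob /cross_step /= !scalerA -scalerDl; congr (_ *: _).
by field; rewrite r_neq0 n_neq0.
Qed.

Lemma sqnorm_cross_step o : sqnorm (cross_step o) = h ^+ 2.
Proof.
rewrite sqnormZ exprMn sqrr_sign mul1r /sqnorm (bigD1 o.1)//= big1 => [|i /negbTE i_neq].
  by rewrite mxE !eqxx expr1n addr0 mulr1.
by rewrite mxE i_neq andbF expr0n.
Qed.

Lemma polyfun_cross_probM d f o : polyfun d f -> polyfun d.+1 (cross_prob ^~ o * f).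
Proof.
move=> Pf; rewrite (_ : _ * f = ((-1) ^+ o.2 / r / (2 * n%:R)) *: (coordinate o.1 * f) +
    (2 * n%:R)^-1 *: f).
  by apply: polyfun_lin; [exact: polyfun_coordinateM|apply: polyfunS; exact: polyfunZ].
apply/funext => x; rewrite /cross_prob /coordinate.
rewrite -[RHS]/(_ * (x ord0 o.1 * f x) + _ * f x) -[LHS]/(_ * f x).
by field; rewrite r_neq0 n_neq0.
Qed.

Lemma polyfun_cross_walk k f s :
  polyfun k.+1 (fun x => walk (cross_prob x) cross_step k f s).
Proof.
elim: k s => [|k IH] s; first exact: polyfun_cst.
rewrite (_ : (fun x => _) = \sum_o cross_prob ^~ o *
    (fun x => walk (cross_prob x) cross_step k f (s + cross_step o))).
  by apply: polyfun_sum => o; exact: polyfun_cross_probM.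
by apply/funext => x; rewrite fct_sumE.
Qed.

End CrossWalk.

Section Weierstrass.
Context {R : realType}.

Lemma compact_quadratic_modulus (V : normedModType R) (K : set V) (f : V -> R) (M e : R) :
  compact K -> 0 < e -> (forall x, `|f x| <= M) -> (forall x, K x -> {for x, continuous f}) ->
  exists2 C, 0 <= C & forall x, K x -> forall y, `|f y - f x| <= e + C * `|y - x| ^+ 2.
Proof.
move=> /compact_near_coveringP Kcpt e0 fM fc.
have f_osc x y : `|f y - f x| <= 2 * M.
  by rewrite (le_trans (ler_normB _ _))// mulr_natl mulr2n lerD.
pose modulus C x := forall y, `|f y - f x| <= e + C * `|y - x| ^+ 2.
suff Kmod : \forall C \near +oo, K `<=` modulus C.
  near (pinfty_nbhs R) => C; exists C; first by near: C; exact: nbhs_pinfty_ge.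
  by near: C.
apply: Kcpt => x Kx; move: (fc _ Kx) => /cvgrPdist_le/(_ (e / 2)).
rewrite divr_gt0// => /(_ isT)/nbhs_normP[d /= d0 fd].
have d2 : 0 < d / 2 by rewrite divr_gt0.
exists ([set y | `|x - y| < d / 2], [set C | 2 * M / (d / 2) ^+ 2 <= C]).
  split=> /=; first by apply/nbhs_normP; exists (d / 2).
  exact: nbhs_pinfty_ge (num_real _).
move=> [x' C] [/= xx' dC] y.
have C0 : 0 <= C.
  apply: le_trans dC; rewrite divr_ge0 ?sqr_ge0// mulr_ge0//.
  exact: le_trans (normr_ge0 _) (fM x).
have [yx'|x'y] := ltP `|y - x'| (d / 2).
  have fyx : `|f x - f y| <= e / 2.
    apply: fd; rewrite /ball_/= (le_lt_trans (ler_distD x' _ _))//.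
    by rewrite [ltRHS]splitr ltrD// distrC.
  have fxx' : `|f x - f x'| <= e / 2.
    by apply: fd; rewrite /ball_/= (lt_trans xx')// ltr_pdivrMr// ltr_pMr// ltr1n.
  rewrite (le_trans (ler_distD (f x) _ _))// distrC.
  by rewrite (le_trans (lerD fyx fxx'))// -splitr lerDl mulr_ge0// sqr_ge0.
rewrite (le_trans (f_osc _ _))//; rewrite ler_pdivrMr ?exprn_gt0// in dC.
rewrite (le_trans dC)// (@le_trans _ _ (C * `|y - x'| ^+ 2))//; last by rewrite lerDr ltW.
by rewrite ler_wpM2l// lerXn2r ?nnegrE// ltW.
Unshelve. all: end_near. Qed.

Lemma compact_continuous_extension (T : pseudoMetricType R) (K : set T) (f : T -> R) :
  hausdorff_space T -> compact K -> {within K, continuous f} ->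
  exists M g, [/\ {in K, f =1 g}, continuous g & forall x, `|g x| <= M].
Proof.
move=> T2 Kcpt fc; have Kcl : closed K by exact: compact_closed.
have [M M0 fM] : exists2 M, 0 < M & forall x, K x -> `|f x| <= M.
  have /ex_strict_bound_gt0[M M0 fM] := compact_bounded (continuous_compact fc Kcpt).
  by exists M => // x Kx; apply/ltW/fM; exists x.
have [g gP] := continuous_bounded_extension pseudometric_normal Kcl M0 fc fM.
by exists M, g.
Qed.

Theorem polyfun_weierstrass n (K : set 'rV[R]_n) (f : 'rV[R]_n -> R) (e : R) :
  compact K -> {within K, continuous f} -> 0 < e ->
  exists d p, polyfun d p /\ forall x, K x -> `|p x - f x| <= e.
Proof.
move=> Kcpt fc e0; have [n0|n_gt0] := posnP n.
  exists 1%N, (cst (f 0)); split=> [|x _]; first exact: polyfun_cst.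
  rewrite (_ : x = 0) ?subrr ?normr0 ?ltW//.
  by apply/rowP => i; have := ltn_ord i; rewrite [X in (_ < X)%N]n0.
have [M [g [fg gc gM]]] := compact_continuous_extension (@norm_hausdorff _ _) Kcpt fc.
have e2 : 0 < e / 2 by rewrite divr_gt0.
have [C C0 g_mod] := compact_quadratic_modulus Kcpt e2 gM (fun x _ => gc x).
have /ex_strict_bound_gt0[r r0 Kr] := compact_bounded Kcpt.
have [N NC] : exists N : nat, C * (n%:R * r) ^+ 2 / (e / 2) <= N.+1%:R.
  by exists (Num.truncn (C * (n%:R * r) ^+ 2 / (e / 2))); apply/ltW/truncnS_gt.
pose h := n%:R * r / N.+1%:R.
exists N.+2, (fun x => walk (cross_prob r x) (cross_step h) N.+1 g 0).
split=> [|x Kx]; first exact: polyfun_cross_walk.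
have h_var : \sum_o cross_prob r x o * sqnorm (cross_step h o) <= h ^+ 2.
  under eq_bigr => o _ do rewrite sqnorm_cross_step.
  by rewrite -mulr_suml cross_prob_sum1// mul1r.
have g_mod_sqdist y : `|g y - g x| <= e / 2 + C * sqdist x y.
  by rewrite (le_trans (g_mod x Kx y))// lerD2l ler_wpM2l// norm_le_sqnorm.
have := walk_approx (fun o => cross_prob_ge0 r0 o (ltW (Kr x Kx))) (cross_prob_sum1 r0 n_gt0 x)
  (cross_step_mean h r0 n_gt0 x) h_var N.+1 0 C0 g_mod_sqdist.
rewrite -fg ?inE// => /le_trans; apply; rewrite [leRHS]splitr lerD2l.
have nr0 : n%:R * r != 0 by rewrite mulf_neq0 ?gt_eqF// ltr0n.
have -> : 0 - x + N.+1%:R *: ((h / (n%:R * r)) *: x) = 0.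
  by rewrite scalerA /h mulrAC mulfV// mul1r mulfV// scale1r sub0r addNr.
rewrite sqnorm0 add0r (_ : N.+1%:R * h ^+ 2 = (n%:R * r) ^+ 2 / N.+1%:R); last first.
  by rewrite /h; field.
by rewrite mulrA ler_pdivrMr// [leRHS]mulrC -ler_pdivrMr.
Qed.

End Weierstrass.

(** * Convex combinations of viscosity subsolutions *)

Section LinearSubsolutions.
Context {R : realType} {n : nat}.
Variable A : 'M[R]_n.
Hypotheses (A_dual : psd_dual A) (A_gt0 : 0 < \tr A).
Variable Omega : set 'rV[R]_n.
Hypothesis Omega_open : open Omega.
Implicit Types (u v : 'rV[R]_n -> R) (z : 'rV[R]_n) (c k r e : R).

Lemma polynomial_majorant c u k z r e :
  {within Omega, continuous u} -> disc_comparison A c Omega u -> k < c ->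
  0 < r -> disc z r `<=` Omega -> 0 < e ->
  exists d h, [/\ polyfun d h, forall x, trhess A h x = k,
    forall x, disc z r x -> u x <= h x & forall x, sqdist z x = r -> h x <= u x + e].
Proof.
move=> uc u_comp kc r0 disc_sub e0; have e2 : 0 < e / 2 by rewrite divr_gt0.
have u_sphere : {within [set x | sqdist z x = r], continuous u}.
  apply: continuous_in_subspaceT => x /set_mem xr.
  by apply: within_open_continuous Omega_open uc _; apply: disc_sub; rewrite /disc/= xr.
have [d [p [Pp pu]]] := polyfun_weierstrass (@compact_sphere R n z r) u_sphere e2.
have Pp_shift : polyfun d.+1 (p + cst (e / 2)).
  by apply: polyfunD; [exact: polyfunS|exact: polyfun_cst].
have [h [Ph hk h_sphere]] := polynomial_dirichlet A_dual A_gt0 z k r0 Pp_shift.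
have hE x : sqdist z x = r -> h x = p x + e / 2 by move=> /h_sphere.
exists d.+3, h; split=> // x xr.
  rewrite -subr_le0; have h2 : C2_on Omega h by exact: C2_on_polyfun Ph.
  apply: (u_comp _ _ _ _ _ kc h2 disc_sub _ _ _ xr) => [y _|y yr].
    by rewrite hk.
  by rewrite subr_le0 hE//; have := pu y yr; rewrite ler_distl lerBlDr => /andP[].
rewrite hE// [e in leRHS]splitr addrA lerD2r.
by have := pu x xr; rewrite ler_distl => /andP[].
Qed.

Lemma disc_comparisonD c1 c2 u v : {within Omega, continuous u} ->
  disc_comparison A c1 Omega u -> disc_comparison A c2 Omega v ->
  disc_comparison A (c1 + c2) Omega (u + v).
Proof.
move=> uc u_comp v_comp k z r m psi kc psi2 disc_sub psik uv_sphere x xr.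
have [r0|r0] := leP r 0.
  apply: uv_sphere; apply/eqP; rewrite eq_le xr (le_trans r0)//.
  exact: sqnorm_ge0.
have [k1 [k1c kk1]] : exists k1, k1 < c1 /\ k - k1 < c2.
  exists ((c1 + (k - c2)) / 2); have kc1 : k - c2 < c1 by rewrite ltrBlDr.
  by have := midf_lt kc1; move=> [? ?]; split; lra.
apply/ler_addgt0Pr => e e0.
have [d [h [Ph hk u_h h_u]]] := polynomial_majorant uc u_comp k1c r0 disc_sub e0.
have h2 : C2_on Omega h by exact: C2_on_polyfun Ph.
have psih2 : C2_on Omega (-1 *: h + psi) by exact: (C2_on_lin _ Omega_open h2 psi2).
have psihE y : (-1 *: h + psi) y = psi y - h y.
  by rewrite -[LHS]/(-1 * h y + psi y) mulN1r addrC.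
have : v x - (-1 *: h + psi) x <= m + e.
  apply: (v_comp _ _ _ _ _ kk1 psih2 disc_sub _ _ _ xr) => [y yr|y yr].
    rewrite (trhess_lin A _ Omega_open h2 psi2 (disc_sub _ yr)) hk mulN1r addrC lerD2r.
    exact: psik.
  have := uv_sphere y yr; rewrite -[(u + v) y]/(u y + v y) psihE.
  by have := h_u y yr; move: (u y) (v y) (h y) (psi y) => ? ? ? ? ? ?; lra.
have := u_h x xr; rewrite -[(u + v) x]/(u x + v x) psihE.
by move: (u x) (v x) (h x) (psi x) => ? ? ? ? ? ?; lra.
Qed.

Lemma visc_subsol_lineqD c1 c2 u v :
  visc_subsol (lineq A c1) Omega u -> visc_subsol (lineq A c2) Omega v ->
  visc_subsol (lineq A (c1 + c2)) Omega (u + v).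
Proof.
move=> u_sub v_sub; apply: disc_comparison_visc_subsol => //.
  by move=> x; apply: continuousD; [exact: u_sub.1|exact: v_sub.1].
by apply: disc_comparisonD u_sub.1 _ _; exact: visc_subsol_disc_comparison.
Qed.

Lemma visc_subsol_lineqZ c u (a : R) : 0 < a ->
  visc_subsol (lineq A c) Omega u -> visc_subsol (lineq A (a * c)) Omega (a *: u).
Proof.
move=> a0 [uc u_sub]; split=> [x|phi z phi2 Oz touch].
  by apply: continuousM; [exact: cst_continuous|exact: uc].
have := u_sub (a^-1 *: phi) z (C2_onZ _ Omega_open phi2) Oz.
rewrite !lineq_hessian (trhessZ _ _ Omega_open phi2 Oz) !subr_ge0 ler_pdivlMl//; apply.
have scaleE x : a * (u x - (a^-1 *: phi) x) = (a *: u) x - phi x.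
  by rewrite mulrBr -[(a^-1 *: phi) x]/(a^-1 * phi x) mulVKf ?gt_eqF.
by apply: filterS touch => x touch_x; rewrite -(ler_pM2l a0) !scaleE.
Qed.

End LinearSubsolutions.

Section ConvexCombination.
Context {R : realType} {n : nat}.
Variables (F : 'M[R]_n -> R) (lam Lam : R) (Omega : set 'rV[R]_n).
Hypothesis Omega_open : open Omega.
Implicit Types (u v phi : 'rV[R]_n -> R) (z : 'rV[R]_n).

Lemma visc_subsol_lineq A (c : R) u : (forall M, superlevel F M -> c <= \tr (A *m M)) ->
  visc_subsol F Omega u -> visc_subsol (lineq A c) Omega u.
Proof.
move=> FA [uc u_sub]; split=> // phi z phi2 Oz touch; rewrite subr_ge0.
by apply: FA; split; [exact: hessian_symmx Omega_open phi2 Oz|exact: u_sub].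
Qed.

Lemma visc_subsol_dim0 u phi z : n = 0 -> visc_subsol F Omega u -> C2_on Omega phi ->
  Omega z -> 0 <= F (hessian phi z).
Proof.
move=> n0 [_ u_sub] phi2 Oz; apply: u_sub => //.
suff eq_z x : x = z by apply: filterE => x; rewrite (eq_z x).
by apply/rowP => i; have := ltn_ord i; rewrite [X in (_ < X)%N]n0.
Qed.

Theorem visc_subsol_convex_combination u v (theta : R) :
  unif_elliptic F lam Lam -> {within [set M | symmx M], continuous F} -> quasiconcave F ->
  visc_subsol F Omega u -> visc_subsol F Omega v -> 0 < theta < 1 ->
  visc_subsol F Omega (theta *: u + (1 - theta) *: v).
Proof.
move=> Fell Fcont Fqc u_sub v_sub /andP[theta0 theta1].
split=> [x|phi z phi2 Oz touch].
  apply: continuousD; apply: continuousM; try exact: cst_continuous.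
    exact: u_sub.1.
  exact: v_sub.1.
have [n0|n_gt0] := posnP n; first exact: visc_subsol_dim0 u_sub phi2 Oz.
rewrite leNgt; apply/negP => Fphi.
have phi_sym := hessian_symmx Omega_open phi2 Oz.
have [A [c [A_dual A_gt0 Aphi FA]]] := superlevel_separation Fell Fcont Fqc n_gt0 phi_sym Fphi.
have theta1' : 0 < 1 - theta by rewrite subr_gt0.
have u_lin := visc_subsol_lineqZ Omega_open theta0 (visc_subsol_lineq FA u_sub).
have v_lin := visc_subsol_lineqZ Omega_open theta1' (visc_subsol_lineq FA v_sub).
have [_ w_lin] := visc_subsol_lineqD A_dual A_gt0 Omega_open u_lin v_lin.
have := w_lin phi z phi2 Oz touch.
by rewrite -mulrDl subrKC mul1r subr_ge0 leNgt Aphi.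
Qed.

End ConvexCombination.

Lemma open_B1 (R : realType) n : open (@B1 R n).
Proof.
rewrite (_ : @B1 R n = sqdist 0 @^-1` [set y | y < 1]).
  by apply: open_comp => [x _|]; [exact: continuous_sqdist|exact: open_lt].
apply/funext => x; rewrite /B1 /= /sqdist subr0 enormE.
by rewrite -{1}(sqrtr1 R) ltr_sqrt.
Qed.

Theorem theorem4p6 (R : realType) (n : nat) (F : 'M[R]_n -> R) (lam Lam : R)
  (u v : 'rV[R]_n -> R) (theta : R) :
  unif_elliptic F lam Lam ->
  {within [set M : 'M[R]_n | symmx M], continuous F} ->
  quasiconcave F ->
  visc_subsol F (@B1 R n) u -> visc_subsol F (@B1 R n) v ->
  0 < theta < 1 ->
  visc_subsol F (@B1 R n) (fun x => theta * u x + (1 - theta) * v x).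
Proof.
move=> Fell Fcont Fqc u_sub v_sub theta01.
exact: (visc_subsol_convex_combination (@open_B1 R n) Fell Fcont Fqc u_sub v_sub theta01).
Qed.
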